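(* Let $P$ be an $n$-dimensional simple polytope with $\gamma$-vector $(\gamma_0,\gamma_1,\ldots,\gamma_{\lfloor n/2\rfloor})$. Then the toric $g$-polynomial of $P$ is $$g(P,x)=\sum_{j=0}^{\lfloor n/2\rfloor}\gamma_j\cdot g_{n,j}(x),$$ where $$g_{n,j}(x)=\sum_{k=0}^{\min(\lfloor n/2\rfloor,\,n-j)} C_{n-k-j}\binom{n-k}{k}(x-1)^k$$ and $C_m=\frac{1}{m+1}\binom{2m}{m}$ is the $m$th Catalan number.
   Context: A polytope of dimension $n$ is simple if every vertex is incident to exactly $n$ facets. Toric $g$-polynomial: for an Eulerian poset $P$ with rank function $\rho$, minimum $\hat 0$ and maximum $\hat 1$, the polynomials $f(P,x)$ and $g(P,x)$ are defined recursively. For the one-element poset, $f=g=1$. If $\operatorname{rank} P=n+1>0$, then $f(P,x)=\sum_{y\in P\setminus\{\hat 1\}} g([\hat 0,y],x)(x-1)^{n-\rho(y)}$; writing $f(P,x)=h_0+h_1x+\cdots+h_nx^n$, one sets $g(P,x)=h_0+(h_1-h_0)x+\cdots+(h_m-h_{m-1})x^m$ with $m=\lfloor n/2\rfloor$. The toric $g$-polynomial $g(P,x)$ of an $n$-dimensional polytope $P$ is that of its face lattice (all faces including the empty face and $P$ itself, ordered by inclusion, of rank $n+1$). $\gamma$-vector: for an $n$-dimensional simple polytope $P$ with $f_i$ faces of dimension $i$ ($0\le i\le n$), the $\gamma$-vector is the unique vector satisfying $\sum_{i=0}^n f_i (x-1)^i=\sum_{j=0}^{\lfloor n/2\rfloor}\gamma_j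 x^j(1+x)^{n-2j}$. *)

(* Defs.v *)
From HB Require Import structures.
From mathcomp Require Import all_boot all_order all_algebra.
Set Implicit Arguments.
Unset Strict Implicit.
Unset Printing Implicit Defensive.
Import Order.TTheory GRing.Theory Num.Theory.
Local Open Scope ring_scope.

Section ToricPolynomials.
Variables (disp : Order.disp_t) (L : finTBPOrderType disp).
Implicit Types (y z : L).

(* Length of a longest chain from the minimum to [y]; this is the rank
   function of [L] as soon as [L] is graded, in particular if it is Eulerian. *)
Definition chain_below y (C : {set L}) : bool :=
  [forall a in C, (a < y)%O && [forall b in C, (a >=< b)%O]].

Definition poset_rank y : nat := \max_(C : {set L} | chain_below y C) #|C|.

(* h_0 + (h_1 - h_0) x + ... + (h_m - h_(m-1)) x^m with m = floor (n / 2). *)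
Definition toric_truncation (n : nat) (h : {poly int}) : {poly int} :=
  \poly_(i < n./2.+1) (h`_i - (if i is k.+1 then h`_k else 0)).

(* Polynomials indexed by [y] are those of the interval from the minimum
   to [y], whose rank is [n + 1] with [n := (poset_rank y).-1].  The argument
   [k] only bounds the recursion depth: see [toric_g_intervalE]. *)
Fixpoint toric_g_rec (k : nat) y : {poly int} :=
  if k is k'.+1 then
    if y == \bot%O then 1 else
    toric_truncation (poset_rank y).-1
      (\sum_(z : L | (z < y)%O)
         toric_g_rec k' z * ('X - 1) ^+ ((poset_rank y).-1 - poset_rank z))
  else 1.

Definition toric_g_interval y : {poly int} := toric_g_rec (poset_rank y) y.

Definition toric_f_interval y : {poly int} :=
  if y == \bot%O then 1 else
  \sum_(z : L | (z < y)%O)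
     toric_g_interval z * ('X - 1) ^+ ((poset_rank y).-1 - poset_rank z).

Lemma poset_rank_lt z y : (z < y)%O -> (poset_rank z < poset_rank y)%N.
Proof.
move=> zy; have ch0 : chain_below z set0.
  by apply/forall_inP => a; rewrite inE.
have -> : poset_rank z = #|[arg max_(C > set0 | chain_below z C) #|C| ]|.
  exact: bigop.bigmax_eq_arg.
case: arg_maxnP => // C /forall_inP chC _.
have zC : z \notin C by apply/negP => /chC; rewrite ltxx.
apply: (@leq_trans #|z |: C|%SET); first by rewrite cardsU1 zC.
apply: (leq_bigmax_cond (F := fun D : {set L} => #|D|)).
apply/forall_inP => a; rewrite !inE => /predU1P[->|aC].
  rewrite zy; apply/forall_inP => b; rewrite !inE => /predU1P[->|/chC].
    by rewrite comparablexx.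
  by case/andP => bz _; rewrite comparable_sym lt_comparable.
have /andP[az /forall_inP ac] := chC _ aC.
rewrite (lt_trans az zy); apply/forall_inP => b.
by rewrite !inE => /predU1P[->|/ac //]; rewrite lt_comparable.
Qed.

Lemma toric_g_rec_stable k y :
  (poset_rank y <= k)%N -> toric_g_rec k y = toric_g_interval y.
Proof.
rewrite /toric_g_interval.
have [r] := ubnP (poset_rank y); elim: r => // r IH in k y *.
rewrite ltnS => yr yk; have [->|y0] := eqVneq y \bot%O.
  by case: k {yk} => [|k]; case: (poset_rank _) => [|?] //=; rewrite eqxx.
have : (poset_rank \bot%O < poset_rank y)%N by rewrite poset_rank_lt // lt0x.
case: k yk => [|k] yk; first by rewrite ltnNge (leq_trans yk).
case ey: (poset_rank y) => [//|q] _ /=; rewrite (negPf y0); congr toric_truncation.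
apply: eq_bigr => z /poset_rank_lt; rewrite ey ltnS => zq.
by rewrite (IH k) ?(IH q) ?ey // ?(leq_trans _ yr) ?ey ?ltnS ?(leq_trans zq) //
           -ltnS -ey.
Qed.

Lemma toric_g_intervalE y :
  toric_g_interval y =
  if y == \bot%O then 1 else
  toric_truncation (poset_rank y).-1 (toric_f_interval y).
Proof.
rewrite -(toric_g_rec_stable (leqnSn _)) /=; case: ifP => // y0.
rewrite /toric_f_interval y0; congr toric_truncation; apply: eq_bigr => z zy.
by rewrite toric_g_rec_stable // ltnW // poset_rank_lt.
Qed.

Definition toric_f : {poly int} := toric_f_interval \top%O.
Definition toric_g : {poly int} := toric_g_interval \top%O.

End ToricPolynomials.

Arguments toric_f {disp} L.
Arguments toric_g {disp} L.

From mathcomp Require Import finmap boolp classical_sets functions cardinality.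
From mathcomp Require Import reals.
Local Open Scope classical_set_scope.

Section Polytopes.
Variables (R : realType) (d : nat).
Implicit Types (P F : set 'rV[R]_d) (V : seq 'rV[R]_d).

Definition convex_hull V : set 'rV[R]_d :=
  [set x | exists l : 'I_(size V) -> R,
     [/\ forall i, 0 <= l i, \sum_i l i = 1 & x = \sum_i l i *: V`_i]].

(* Intersections with supporting hyperplanes; [a = 0] yields [P] and [set0]. *)
Definition faces P : set (set 'rV[R]_d) :=
  [set F | exists (a : 'cV[R]_d) (b : R),
     (forall x, P x -> (x *m a) 0 0 <= b) /\
     F = [set x | P x /\ (x *m a) 0 0 = b]].

(* [U] is the direction of the affine hull of [F]; the empty set has no
   dimension. *)
Definition has_dim F (k : nat) : Prop :=
  exists2 x0, F x0 & exists U : {vspace 'rV[R]_d},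
    [/\ \dim U = k, forall x, F x -> x - x0 \in U &
        forall W : {vspace 'rV[R]_d},
          (forall x, F x -> x - x0 \in W) -> (U <= W)%VS].

Record polytope := Polytope {
  polytope_set :> set 'rV[R]_d;
  polytopeP : exists V, polytope_set = convex_hull V }.

Lemma face_hull V (a : 'cV[R]_d) (b : R) :
  (forall x, convex_hull V x -> (x *m a) 0 0 <= b) ->
  [set x | convex_hull V x /\ (x *m a) 0 0 = b] =
  [set x | exists l : 'I_(size V) -> R,
     [/\ forall i, 0 <= l i, \sum_i l i = 1, x = \sum_i l i *: V`_i
       & forall i : 'I_(size V), (V`_i *m a) 0 0 != b -> l i = 0]].
Proof.
move=> Pb.
have lin (l : 'I_(size V) -> R) :
    ((\sum_i l i *: V`_i) *m a) 0 0 = \sum_i l i * (V`_i *m a) 0 0.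
  rewrite mulmx_suml summxE; apply: eq_bigr => i _.
  by rewrite -scalemxAl mxE.
have vb (i : 'I_(size V)) : (V`_i *m a) 0 0 <= b.
  apply: Pb; exists (fun j => (j == i)%:R); split.
  - by move=> j; rewrite ler0n.
  - by rewrite (bigD1 i) //= eqxx big1 ?addr0 // => j /negPf ->.
  - rewrite (bigD1 i) //= eqxx scale1r big1 ?addr0 // => j /negPf ->.
    by rewrite scale0r.
apply/seteqP; split => x /=.
  case=> -[l [l0 l1 ->]] xb; exists l; split=> // i vi.
  have : \sum_i l i * (b - (V`_i *m a) 0 0) = 0.
    under eq_bigr do rewrite mulrBr.
    by rewrite sumrB -mulr_suml l1 mul1r -lin xb subrr.
  move/eqP; rewrite psumr_eq0; last first.
    by move=> j _; rewrite mulr_ge0 ?subr_ge0.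
  move/allP/(_ i (mem_index_enum _)); rewrite mulf_eq0 subr_eq0.
  by rewrite [b == _]eq_sym (negPf vi) orbF => /eqP.
case=> l [l0 l1 xl lb]; split; first by exists l.
rewrite xl lin -[RHS]mul1r -l1 mulr_suml; apply: eq_bigr => i _.
by have [->//|/lb ->] := eqVneq ((V`_i *m a) 0 0) b; rewrite !mul0r.
Qed.

Lemma finite_faces (P : polytope) : finite_set (faces P).
Proof.
have [V ->] := polytopeP P.
pose hull_on (I : {set 'I_(size V)}) : set 'rV[R]_d :=
  [set x | exists l : 'I_(size V) -> R,
     [/\ forall i, 0 <= l i, \sum_i l i = 1, x = \sum_i l i *: V`_i
       & forall i, i \notin I -> l i = 0]].
apply: (@sub_finite_set _ _ (hull_on @` [set: {set 'I_(size V)}])); last first.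
  exact: finite_image.
move=> _ [a [b [Pb ->]]].
exists [set i : 'I_(size V) | (V`_i *m a) 0 0 == b]%SET => //.
rewrite face_hull // /hull_on; apply/seteqP.
split=> x [l [l0 l1 xl lb]]; exists l; split=> // i.
  by move=> vi; apply: lb; rewrite inE.
by rewrite inE; apply: lb.
Qed.

Section FaceLattice.
Variable P : polytope.

Definition face_lattice : Type := fset_set (faces P).

HB.instance Definition _ := SubType.copy face_lattice (fset_set (faces P)).
HB.instance Definition _ := Finite.copy face_lattice (fset_set (faces P)).
HB.instance Definition _ :=
  [SubChoice_isSubPOrder of face_lattice by <: with set_display].

Lemma face_latticeP (F : face_lattice) : faces P (val F).
Proof.
by apply: set_mem; rewrite -(in_fset_set (finite_faces P)); apply: valP.
Qed.

Lemma face_latticeI F : faces P F -> F \in fset_set (faces P).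
Proof. by move=> PF; rewrite (in_fset_set (finite_faces P)) mem_set. Qed.

Lemma faces0 : faces P set0.
Proof.
exists 0, 1; split=> [x _|]; first by rewrite mulmx0 mxE.
apply/seteqP; split=> x //= -[_]; rewrite mulmx0 mxE => /eqP.
by rewrite eq_sym oner_eq0.
Qed.

Lemma facesT : faces P P.
Proof.
exists 0, 0; split=> [x _|]; first by rewrite mulmx0 mxE.
by apply/seteqP; split=> x /= => [Px|[]//]; rewrite mulmx0 mxE.
Qed.

Definition empty_face : face_lattice := [` face_latticeI faces0]%fset.
Definition full_face : face_lattice := [` face_latticeI facesT]%fset.

Lemma empty_face_le (F : face_lattice) : (empty_face <= F)%O.
Proof. by rewrite -Order.le_val /= le0x. Qed.

Lemma le_full_face (F : face_lattice) : (F <= full_face)%O.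
Proof.
rewrite -Order.le_val /=; apply/subsetPset.
by have [a [b [_ ->]]] := face_latticeP F => x [].
Qed.

HB.instance Definition _ :=
  Order.hasBottom.Build set_display face_lattice empty_face_le.
HB.instance Definition _ :=
  Order.hasTop.Build set_display face_lattice le_full_face.

Lemma face_lattice_leP (F G : face_lattice) :
  reflect (val F `<=` val G) (F <= G)%O.
Proof. by rewrite -Order.le_val; apply: subsetPset. Qed.

Definition f_number (i : nat) : nat :=
  #|[set F : face_lattice | `[< has_dim (val F) i >]]%SET|.

Definition is_vertex (F : face_lattice) : Prop := has_dim (val F) 0.

Definition is_facet (n : nat) (F : face_lattice) : Prop :=
  exists2 k, has_dim (val F) k & k.+1 = n.

Definition is_simple (n : nat) : Prop :=
  forall v : face_lattice, is_vertex v ->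
    #|[set F : face_lattice | `[< is_facet n F >] && (v <= F)%O]%SET| = n.

Definition is_gamma_vector (n : nat) (gamma : 'I_(n./2).+1 -> int) : Prop :=
  \sum_(i < n.+1) (f_number i)%:R * ('X - 1) ^+ i =
  \sum_(j < (n./2).+1) gamma j *: ('X^j * (1 + 'X) ^+ (n - 2 * j))
    :> {poly int}.

End FaceLattice.
End Polytopes.

Arguments is_gamma_vector {R d} P n gamma.

Definition catalan (m : nat) : nat := 'C(2 * m, m) %/ m.+1.

(* The division above is exact. *)
Lemma catalanE (m : nat) : (catalan m * m.+1)%N = 'C(2 * m, m).
Proof.
apply/eqP; rewrite -dvdn_eq mul2n.
have e : (m.+1 * 'C(m.*2, m.+1) = m * 'C(m.*2, m))%N.
  by rewrite mul_bin_left -[X in (X - m)%N]addnn addnK.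
have -> : 'C(m.*2, m) = (m.+1 * 'C(m.*2, m) - m.+1 * 'C(m.*2, m.+1))%N.
  by rewrite e -mulnBl subSnn mul1n.
by rewrite dvdn_sub ?dvdn_mulr.
Qed.

Definition g_nj (n j : nat) : {poly int} :=
  \sum_(k < (minn n./2 (n - j)).+1)
     (catalan (n - k - j) * 'C(n - k, k))%:R * ('X - 1) ^+ k.

(* Main.v *)
From HB Require Import structures.
Require Import Defs.
From mathcomp Require Import finmap boolp classical_sets.
From mathcomp Require Import all_boot all_order all_algebra.
From mathcomp Require Import reals zify ring lra.
Set Implicit Arguments.
Unset Strict Implicit.
Unset Printing Implicit Defensive.
Import Order.TTheory GRing.Theory Num.Theory.
Local Open Scope ring_scope.

(** Write [q = x - 1] and let [h_P] be the sum of [q ^ dim F] over the nonempty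
faces [F] of [P]; the gamma-vector is the expansion of [h_P] in the basis
[x^j (1+x)^(n-2j)].

Passing from a polytope to its faces is linear on the level of [h].  In a
simple polytope a nonempty [k]-face [E] of an [m]-face [G] lies in exactly
[binomial(m-k, m-i)] of the [i]-faces of [G], so the sum of [h_F] over the
[i]-faces [F] of [G] is obtained from [h_G] by an operator which depends only
on [m] and [i] ([iface_sum_face_poly]).  With [h] homogenised in two variables
[X], [Y], it extracts the coefficient of [t^(m-i)] after the translation
[X -> X + t], [Y -> Y + t].  This translation preserves symmetry: with
[s = X + Y] and [p = XY] it is [s -> s + 2t], [p -> p + ts + t^2].  Hence a
formal combination of [m]-faces with symmetric [h] has, in each lower
dimension, a combination of faces with symmetric [h] again, and the formula for
[g] can be proved by induction on the dimension for all formal combinations of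
faces whose [h] is a combination of the basis elements ([gamma_expansion]).

What the induction step asks for is an identity between the polynomials
[g_nj].  It becomes transparent with the linear functional [L] that sends
[s^a] to [g_nj a 0]: Pascal's rule gives [g_nj n j = L (s^(n-2j) (s+q)^j)]
([catalan_sum_umbral]), which says that [L] computes [g] from the symmetric
polynomial [h] after the substitution [p = s + q].  The faces of all dimensions
are then summed by putting [t = q], which turns [p + ts + t^2] into
[x (s + q)] and [s + 2t] into [s + 2q].  The outcome is [x^(n+1) g(1/x)] up to a
multiple of [q^(n+1)] ([kernel_sum]), whose low coefficients vanish, and this is
exactly what characterises the truncation in the definition of [g].  By
linearity this reduces to powers of [s], which correspond to cubes
([cube_identity]); there both sides have generating functions that solve the
same quadratic equation, inherited from that of the Catalan numbers.

On the geometric side, all that is used of a polytope is that a face [F] of a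
face [G] of codimension at least two is the intersection of two faces strictly
between [F] and [G] ([face_rank_gap]): rotate a supporting hyperplane of [F]
about [F] in both directions until it hits further vertices.  For a ranked
poset this property gives gradedness, makes every element a meet of coatoms
and, when exactly [n] coatoms lie over each atom, makes the intervals above
elements other than the minimum Boolean ([coatoms_above_onto]). *)

(** * Catalan numbers and their generating function *)
Lemma catalan0 : catalan 0 = 1%N. Proof. by []. Qed.

Lemma catalanS (k : nat) : (k.+2 * catalan k.+1 = (4 * k + 2) * catalan k)%N.
Proof.
have e1 := catalanE k; have e2 := catalanE k.+1.
have e3 : ('C(2 * k.+1, k.+1) * k.+1 = (2 * (2 * k + 1)) * 'C(2 * k, k))%N.
  have a1 : (k.+1 * 'C((2 * k).+2, k.+1) = (2 * k).+2 * 'C((2 * k).+1, k))%N.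
    by rewrite mul_bin_diag.
  have a2 : ('C((2 * k).+1, k) = 'C((2 * k).+1, k.+1))%N.
    by rewrite -[LHS]bin_sub; [congr 'C(_, _); lia | lia].
  have a3 : (k.+1 * 'C((2 * k).+1, k.+1) = (2 * k).+1 * 'C(2 * k, k))%N.
    by rewrite mul_bin_diag.
  have -> : (2 * k.+1 = (2 * k).+2)%N by lia.
  nia.
nia.
Qed.

(** The convolution is symmetric, so its weight [i + 1] averages to [(n + 2) / 2];
shifting the index and applying [catalanS] then yields for the convolution the
same first-order recurrence as for the Catalan numbers. *)
Lemma catalan_segner (n : nat) :
  catalan n.+1 = (\sum_(i < n.+1) catalan i * catalan (n - i))%N.
Proof.
pose S n := (\sum_(i < n.+1) catalan i * catalan (n - i))%N.
have sym m : (2 * (\sum_(i < m.+1) i * (catalan i * catalan (m - i))) = m * S m)%N.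
  rewrite mul2n -addnn {1}(reindex_inj rev_ord_inj) /= -big_split /S big_distrr /=.
  apply: eq_bigr => i _; rewrite subSS subKn ?leq_ord //.
  by rewrite (mulnC (catalan (m - i))) -mulnDl subnK // leq_ord.
elim: n => [|n IH]; first by rewrite big_ord1.
have e : (2 * (\sum_(i < n.+2) i.+1 * (catalan i * catalan (n.+1 - i))) =
          (n + 3) * S n.+1)%N.
  under eq_bigr do rewrite mulSn.
  by rewrite big_split /= mulnDr sym -/(S _); lia.
have e' : ((\sum_(i < n.+2) i.+1 * (catalan i * catalan (n.+1 - i))) =
          catalan n.+1 + (2 * n + 2) * S n)%N.
  rewrite big_ord_recl /= subn0 catalan0 !mul1n; congr addn.
  transitivity (2 * (2 * (\sum_(i < n.+1) i * (catalan i * catalan (n - i)))) + 2 * S n)%N.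
    rewrite /S !big_distrr /= -big_split /=; apply: eq_bigr => i _.
    rewrite /bump /= add1n subSS mulnA catalanS.
    by move: (catalan (n - i)) (catalan i) => a b; ring.
  by rewrite sym; move: (S n) => z; ring.
rewrite -/(S n) in IH; rewrite -/(S n.+1); rewrite e' -IH in e.
apply/eqP; rewrite -(eqn_pmul2l (ltn0Sn n.+2)) catalanS.
by move: e; move: (catalan n.+1) (S n.+1) => a b e; apply/eqP; lia.
Qed.

Section Series.
Variable A : comNzRingType.
Implicit Types p r Q : {poly A}.

(** Power series are represented by polynomials up to multiples of ['X^N]; the
explicit quotient lets [ring] handle congruences. *)
Definition eqX N p r := exists Q, p = r + 'X^N * Q.

Lemma eqXP N p r : (forall i, (i < N)%N -> p`_i = r`_i) <-> eqX N p r.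
Proof.
split=> [h|[Q ->] i iN]; last first.
  by rewrite coefD coefXnM iN addr0.
exists (drop_poly N (p - r)).
have e := poly_take_drop N (p - r).
have t0 : take_poly N (p - r) = 0.
  by apply/polyP => i; rewrite coef_take_poly coef0 coefB; case: ifP => // /h ->; rewrite subrr.
by rewrite t0 add0r in e; rewrite mulrC e addrC subrK.
Qed.

Lemma eqX_refl N p : eqX N p p. Proof. by exists 0; rewrite mulr0 addr0. Qed.
Lemma eqX_sym N p r : eqX N p r -> eqX N r p.
Proof. by case=> Q ->; exists (- Q); ring. Qed.
Lemma eqX_trans N p r s : eqX N p r -> eqX N r s -> eqX N p s.
Proof. by case=> Q -> [T ->]; exists (Q + T); ring. Qed.
Lemma eqXM N p r p' r' : eqX N p r -> eqX N p' r' -> eqX N (p * p') (r * r').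
Proof. by case=> Q -> [T ->]; exists (Q * r' + r * T + 'X^N * Q * T); ring. Qed.
Lemma eqXD N p r p' r' : eqX N p r -> eqX N p' r' -> eqX N (p + p') (r + r').
Proof. by case=> Q -> [T ->]; exists (Q + T); ring. Qed.
Lemma eqX_exp N p r k : eqX N p r -> eqX N (p ^+ k) (r ^+ k).
Proof.
by move=> h; elim: k => [|k IH]; [exact: eqX_refl | rewrite !exprS; apply: eqXM].
Qed.
Lemma eqX_sum N (I : finType) (F G : I -> {poly A}) :
  (forall i, eqX N (F i) (G i)) -> eqX N (\sum_i F i) (\sum_i G i).
Proof.
move=> h; elim/big_ind2: _ => [|? ? ? ? h1 h2|i _]; [exact: eqX_refl| exact: eqXD| exact: h].
Qed.

Lemma eqX_comp N p r s : eqX N p r -> eqX N (p \Po ('X * s)) (r \Po ('X * s)).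
Proof.
case=> Q ->; exists (s ^+ N * (Q \Po ('X * s))).
by rewrite comp_polyD comp_polyM comp_Xn_poly exprMn mulrA.
Qed.

(** The difference [D] of two solutions satisfies [D = 'X * e * (U + W) * D], so
it is divisible by every power of ['X]. *)
Lemma quadratic_unique N a e U W :
  eqX N U (a + 'X * e * U ^+ 2) -> eqX N W (a + 'X * e * W ^+ 2) -> eqX N U W.
Proof.
move=> [Q1 hU] [Q2 hW].
suff /(_ N (leqnn N)) [D hD] : forall M, (M <= N)%N -> exists D, U - W = 'X^M * D.
  by exists D; rewrite -hD addrC subrK.
elim=> [|M IH] MN; first by exists (U - W); rewrite expr0 mul1r.
have [D hD] := IH (ltnW MN).
exists (e * (U + W) * D + 'X^(N - M.+1) * (Q1 - Q2)).
have -> : U - W = 'X * e * (U + W) * (U - W) + 'X^N * (Q1 - Q2).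
  by rewrite {1}hU {1}hW; ring.
by rewrite hD -{1}(subnKC MN) exprD exprS; ring.
Qed.

(** Besides [g_nj n j], the case [u = 1] and [w = x - 1], this covers its
reversal [x^n g_nj(1/x)], the case [u = x] and [w = 1 - x]. *)
Definition catalan_sum (u w : A) n j : A :=
  \sum_(k < n./2.+1) (catalan (n - k - j) * 'C(n - k, k))%:R * u ^+ (n - k) * w ^+ k.

Definition catalan_series N : {poly A} := \poly_(m < N) (catalan m)%:R.

Lemma catalan_series_quadratic N :
  eqX N (catalan_series N) (1 + 'X * catalan_series N ^+ 2).
Proof.
apply/eqXP => i iN; rewrite coefD coef1 coefXM coef_poly iN.
case: i iN => [|i] iN /=; first by rewrite addr0.
rewrite add0r expr2 coefM catalan_segner natr_sum; apply: eq_bigr => k _.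
by rewrite !coef_poly !ifT ?natrM //; have := ltn_ord k; lia.
Qed.

Definition catalan_sum_series (u w : A) N : {poly A} := \poly_(n < N) catalan_sum u w n 0.

(** With [m = n - k], the sum collects the coefficients of
[C_m (u X (1 + w X))^m]. *)
Lemma catalan_sum_seriesE (u w : A) N :
  eqX N (catalan_sum_series u w N) (catalan_series N \Po ('X * (u%:P * (1 + w%:P * 'X)))).
Proof.
apply/eqXP => n nN; rewrite coef_poly nN /catalan_series.
rewrite poly_def raddf_sum /= coef_sum.
have term m : (((catalan m)%:R *: 'X^m : {poly A}) \Po ('X * (u%:P * (1 + w%:P * 'X))))`_n
  = if (m <= n)%N then (catalan m * 'C(m, n - m))%:R * u ^+ m * w ^+ (n - m) else 0.
  rewrite comp_polyZ comp_Xn_poly !exprMn coefZ coefXnM ltnNge.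
  case: leqP => mn /=; last by rewrite mulr0.
  rewrite -rmorphXn /= coefCM exprDn.
  under eq_bigr do rewrite expr1n mul1r exprMn -rmorphXn /= -mulrnAl.
  rewrite coef_sum.
  have c (k : 'I_m.+1) : ((((w ^+ k)%:P : {poly A}) *+ 'C(m, k) * 'X^k))`_(n - m) =
     if k == (n - m)%N :> nat then w ^+ k *+ 'C(m, k) else 0.
    by rewrite -polyCMn coefCM coefXn eq_sym; case: eqP => _; rewrite ?mulr1 ?mulr0.
  under eq_bigr do rewrite c.
  rewrite -big_mkcond /= natrM -!mulrA; congr (_ * _); rewrite mulrCA; congr (_ * _).
  case: (ltnP (n - m) m.+1) => h.
    by rewrite (big_pred1 (Ordinal h)) // -mulr_natl.
  rewrite bin_small // mul0r big_pred0 // => k; apply/negbTE/eqP.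
  by have := ltn_ord k; lia.
under eq_bigr do rewrite term.
rewrite -(big_mkord xpredT (fun m => if (m <= n)%N then
   (catalan m * 'C(m, n - m))%:R * u ^+ m * w ^+ (n - m) else 0)).
rewrite (big_cat_nat _ (n := n.+1)) //= [X in _ + X]big_nat_cond.
rewrite [X in _ + X]big1 ?addr0; last by move=> i; case: ltnP => //; rewrite andbF.
rewrite big_nat_rev /= big_mkord /catalan_sum.
rewrite [RHS](bigID (fun i : 'I_n.+1 => (i < n./2.+1)%N)) /= [X in _ = _ + X]big1 ?addr0.
  rewrite (big_ord_widen_cond n.+1 xpredT (fun k =>
    (catalan (n - k - 0) * 'C(n - k, k))%:R * u ^+ (n - k) * w ^+ k)) /=; last lia.
  apply: eq_bigr => i _; have := ltn_ord i => ?.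
  by rewrite add0n subSS leq_subr subn0 subKn // -ltnS.
move=> i; rewrite -leqNgt => h; have := ltn_ord i => ?.
rewrite add0n subSS leq_subr bin_small ?muln0 ?mul0r //; lia.
Qed.

Lemma catalan_sum_series_quadratic (u w : A) N :
  eqX N (catalan_sum_series u w N)
    (1 + 'X * (u%:P * (1 + w%:P * 'X)) * catalan_sum_series u w N ^+ 2).
Proof.
set s := u%:P * _; have e := catalan_sum_seriesE u w N; rewrite -/s in e.
apply: (eqX_trans e); apply: (eqX_trans (eqX_comp s (catalan_series_quadratic N))).
rewrite comp_polyD comp_polyM comp_polyX rmorphXn /= comp_polyC.
apply: eqXD; first exact: eqX_refl.
by apply: eqXM; [exact: eqX_refl | apply/eqX_exp/eqX_sym].
Qed.
End Series.

(** * The linear functional behind the polynomials [g_nj] *)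
Section Umbral.
Variable A : comNzRingType.
Implicit Types (m : nat -> A) (p r : {poly A}).

Definition umbral m p : A := \sum_(i < size p) p`_i * m i.

Lemma umbral_widen m N p : (size p <= N)%N -> umbral m p = \sum_(i < N) p`_i * m i.
Proof.
move=> sN; rewrite /umbral (big_ord_widen_cond N xpredT (fun i => p`_i * m i)) //=.
by rewrite big_mkcond; apply: eq_bigr => i _; case: ltnP => // ?; rewrite nth_default ?mul0r.
Qed.

Fact umbral_is_linear m : linear_for *%R (umbral m).
Proof.
move=> a p r; set N := maxn (size (a *: p + r)) (maxn (size p) (size r)).
rewrite !(umbral_widen m (N := N)) ?leq_max ?leqnn ?orbT //.
rewrite mulr_sumr -big_split; apply: eq_bigr => i _ /=.
by rewrite coefD coefZ mulrDl mulrA.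
Qed.
HB.instance Definition _ m :=
  GRing.isLinear.Build A {poly A} A *%R (umbral m) (umbral_is_linear m).

Lemma umbralX m n : umbral m 'X^n = m n.
Proof.
rewrite (umbral_widen m (N := n.+1)) ?size_polyXn // big_ord_recr /= coefXn eqxx mul1r.
by rewrite big1 ?add0r // => i _; rewrite coefXn ltn_eqF ?mul0r // ltn_ord.
Qed.

Lemma umbralC m a p : umbral m (a%:P * p) = a * umbral m p.
Proof. by rewrite mul_polyC linearZ. Qed.

(** Pascal's rule is the recurrence [c(n,j) = u c(n-1,j-1) + u w c(n-2,j-1)]
for these sums; each step trades a factor [u s + u w] for a lower [j]. *)
Lemma catalan_sum_umbral (u w : A) N j :
  catalan_sum u w (N + 2 * j) j =
  umbral (fun a => catalan_sum u w a 0) ('X^N * (u%:P * 'X + (u * w)%:P) ^+ j).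
Proof.
elim: j N => [|j IH] N; first by rewrite muln0 addn0 expr0 mulr1 umbralX.
have -> : 'X^N * (u%:P * 'X + (u * w)%:P) ^+ j.+1 =
  u%:P * ('X^(N.+1) * (u%:P * 'X + (u * w)%:P) ^+ j) +
  (u * w)%:P * ('X^N * (u%:P * 'X + (u * w)%:P) ^+ j) by rewrite !exprS; ring.
rewrite linearD /= !umbralC -!IH /catalan_sum.
have -> : (N + 2 * j.+1 = (N + 2 * j).+2)%N by lia.
rewrite addSn; set n := (N + 2 * j)%N.
have jn : (2 * j <= n)%N by rewrite leq_addl.
have aux : ((n.+1)./2.+1 <= n.+2./2.+1)%N by lia.
rewrite (big_ord_widen_cond _ xpredT (fun k =>
  (catalan (n.+1 - k - j) * 'C(n.+1 - k, k))%:R * u ^+ (n.+1 - k) * w ^+ k) aux) /=.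
rewrite [in X in _ = X + _]big_mkcond mulr_sumr [in X in _ = _ + X]mulr_sumr.
rewrite [X in _ = _ + X](_ : _ = \sum_(k < n.+2./2.+1) if (0 < k)%N then
   u * w * ((catalan (n - k.-1 - j) * 'C(n - k.-1, k.-1))%:R *
            u ^+ (n - k.-1) * w ^+ k.-1) else 0); last first.
  by rewrite [RHS]big_ord_recl /= add0r; apply: eq_bigr.
rewrite -big_split /=; apply: eq_bigr => k _.
have kn := ltn_ord k.
have e1 : (n.+2 - k = (n.+1 - k).+1)%N by lia.
case: ltnP => hk; case: (posnP k) => k0 /=.
- rewrite k0 !subn0 !bin0 !muln1 !expr0 addr0 exprS.
  have -> : (n.+2 - j.+1 = n.+1 - j)%N by lia.
  ring.
- have -> : (n.+2 - k - j.+1 = n.+1 - k - j)%N by lia.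
  have -> : (n - k.-1 = n.+1 - k)%N by lia.
  rewrite e1; case ek: (nat_of_ord k) k0 => [//|k'] _ /=.
  rewrite binS mulnDr natrD !exprS; ring.
- lia.
- have -> : (n.+2 - k - j.+1 = n.+1 - k - j)%N by lia.
  have -> : (n - k.-1 = n.+1 - k)%N by lia.
  rewrite e1; case ek: (nat_of_ord k) k0 => [//|k'] _ /=.
  rewrite binS (@bin_small (n.+1 - k'.+1) k'.+1); last lia.
  rewrite add0n !exprS; ring.
Qed.

Section Binomial.
Variables (r : A) (N : nat).
Let D : {poly A} := 1 - r%:P * 'X.
Let iota_ : {poly A} := \poly_(k < N) (r ^+ k).

Lemma geometric_inverse : eqX N (D * iota_) 1.
Proof.
apply/eqXP => i iN; rewrite mulrBl mul1r coefB -mulrA coefCM coefXM !coef_poly iN coef1.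
by case: i iN => [|i] iN /=; rewrite ?mulr0 ?subr0 // (ltnW iN) exprS subrr.
Qed.

Let B M : {poly A} := \poly_(n < N) (r ^+ (n - M) *+ 'C(n, M)).

(** [B M] is the expansion of ['X^M / (1 - r 'X)^(M+1)]. *)
Lemma binomial_series M : eqX N (D ^+ M.+1 * B M) 'X^M.
Proof.
elim: M => [|M IH].
  apply: (eqX_trans _ geometric_inverse); rewrite expr1; apply: eqXM; first exact: eqX_refl.
  by apply/eqXP => i iN; rewrite !coef_poly iN subn0 bin0.
have : eqX N (D * B M.+1) ('X * B M).
  apply/eqXP => i iN; rewrite mulrBl mul1r coefB -mulrA coefCM !coefXM !coef_poly iN.
  case: i iN => [|i] iN /=; first by rewrite mulr0 subr0 sub0n bin0n.
  rewrite (ltnW iN) binS mulrnDr subSS.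
  case: (ltnP i M.+1) => h; first by rewrite bin_small // !mulr0n mulr0 add0r subr0.
  rewrite mulrnAr -exprS; have -> : (i - M = (i - M.+1).+1)%N by lia.
  by rewrite addrAC subrr add0r.
move=> h; rewrite (exprSr D) -mulrA; apply: (eqX_trans (eqXM (eqX_refl _ _) h)).
by rewrite mulrCA (exprS 'X); apply: eqXM => //; exact: eqX_refl.
Qed.

(** Euler's transformation: the binomial transform of a sequence corresponds to
the substitution ['X / (1 - r 'X)] in its generating function. *)
Lemma binomial_transform (a : nat -> A) :
  eqX N (D * \poly_(n < N) umbral a (('X + r%:P) ^+ n))
        (\poly_(n < N) a n \Po ('X * iota_)).
Proof.
have h M : eqX N (D * B M) (('X * iota_) ^+ M).
  have g := eqX_exp M geometric_inverse; rewrite expr1n exprMn in g.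
  have := eqXM (binomial_series M) (eqX_refl N (iota_ ^+ M)).
  rewrite exprSr -exprMn => h; apply: (eqX_trans _ h).
  have -> : D ^+ M * D * B M * iota_ ^+ M = D ^+ M * iota_ ^+ M * (D * B M) by ring.
  apply: eqX_sym; rewrite -[X in eqX _ _ X]mul1r; apply: eqXM => //; exact: eqX_refl.
have -> : \poly_(n < N) umbral a (('X + r%:P) ^+ n) = \sum_(M < N) a M *: B M.
  apply/polyP => n; rewrite coef_poly coef_sum.
  case: ltnP => nN; last by rewrite big1 // => M _; rewrite coefZ coef_poly ltnNge nN mulr0.
  have -> : umbral a (('X + r%:P) ^+ n) = \sum_(k < n.+1) (r ^+ (n - k) *+ 'C(n, k)) * a k.
    rewrite addrC exprDn linear_sum; apply: eq_bigr => k _.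
    by rewrite -mulrnAl -rmorphXn -polyCMn /= umbralC umbralX.
  rewrite (big_ord_widen_cond N xpredT (fun k => (r ^+ (n - k) *+ 'C(n, k)) * a k)) //=.
  rewrite big_mkcond; apply: eq_bigr => k _; rewrite coefZ coef_poly nN mulrC.
  by case: ltnP => // lt; rewrite bin_small // mulr0n mulr0.
rewrite mulr_sumr [X in X \Po _]poly_def raddf_sum; apply: eqX_sum => M /=.
rewrite comp_polyZ comp_Xn_poly -scalerAr -!mul_polyC.
by apply: eqXM; [exact: eqX_refl | exact: h].
Qed.
End Binomial.

(** The case [j = 0] of the kernel identity, which is the one of the [n]-cube.
The generating function [Y] of the umbral values satisfies
[(1 - 2q X) Y = 1 + X (1 - q X) Y^2] by Euler's transformation of the Catalan
equation.  Completing the square with [Y + q / (1 - q X)] removes the linear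
term and leaves the quadratic equation of the right-hand side. *)
Lemma cube_identity (q : A) n :
  umbral (fun a => catalan_sum 1 q a 0) (('X + (2 * q)%:P) ^+ n) + q ^+ n.+1 =
  (1 + q) * catalan_sum (1 + q) (- q) n 0.
Proof.
pose N := n.+1; pose r := 2 * q.
pose D : {poly A} := 1 - r%:P * 'X; pose it : {poly A} := \poly_(k < N) (r ^+ k).
pose Y := \poly_(n < N) umbral (fun a => catalan_sum 1 q a 0) (('X + r%:P) ^+ n).
pose ka : {poly A} := \poly_(k < N) (q ^+ k).
pose G := catalan_sum_series 1 q N \Po ('X * it).
have DY : eqX N (D * Y) G by exact: binomial_transform.
have Dit : eqX N (D * it) 1 by exact: geometric_inverse.
have hka : eqX N ((1 - q%:P * 'X) * ka) 1 by exact: geometric_inverse.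
have qY : eqX N (D * Y) (1 + 'X * (1 - q%:P * 'X) * Y ^+ 2).
  apply: (eqX_trans DY); apply: (eqX_trans (eqX_comp it (catalan_sum_series_quadratic 1 q N))).
  rewrite mul1r !(comp_polyD, comp_polyM, comp_polyX, comp_polyC) -/G.
  apply: eqXD; first exact: eqX_refl.
  rewrite -expr2.
  apply: (eqX_trans (eqXM (eqX_refl _ _) (eqX_exp 2 (eqX_sym DY)))).
  have -> : 'X * it * (1 + q%:P * ('X * it)) * (D * Y) ^+ 2 =
    'X * (D * it * D + q%:P * 'X * (D * it) ^+ 2) * Y ^+ 2 by ring.
  apply: eqXM (eqX_refl _ _); apply: eqXM; first exact: eqX_refl.
  have -> : 1 - q%:P * 'X = 1 * D + q%:P * 'X * 1 ^+ 2.
    by rewrite /D /r rmorphM rmorph_nat; ring.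
  apply: eqXD; first by apply: eqXM (eqX_refl _ _).
  by apply: eqXM; [exact: eqX_refl | exact: eqX_exp].
have : eqX N (Y + q%:P * ka) ((1 + q)%:P * catalan_sum_series (1 + q) (- q) N).
  apply: (@quadratic_unique A N (1 + q)%:P (1 - q%:P * 'X)).
    case: qY => Q1 h1; case: hka => Q2 h2.
    exists (q%:P * Q2 + Q1 - 2 * q%:P * 'X * Y * Q2 - q%:P ^+ 2 * 'X * ka * Q2).
    have h1' : 'X * (1 - q%:P * 'X) * Y ^+ 2 = D * Y - 1 - 'X^N * Q1 by rewrite h1; ring.
    have -> : (1 + q)%:P + 'X * (1 - q%:P * 'X) * (Y + q%:P * ka) ^+ 2 =
       1 + q%:P + 'X * (1 - q%:P * 'X) * Y ^+ 2 +
       2 * q%:P * 'X * Y * ((1 - q%:P * 'X) * ka) +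
       q%:P ^+ 2 * 'X * ka * ((1 - q%:P * 'X) * ka) by rewrite rmorphD; ring.
    have h3 : q%:P * ka = q%:P * (1 + 'X^N * Q2) + q%:P ^+ 2 * 'X * ka.
      by rewrite -h2; ring.
    by rewrite h1' h2 {1}h3 /D /r rmorphM rmorph_nat; ring.
  case: (catalan_sum_series_quadratic (1 + q) (- q) N) => Q h.
  exists ((1 + q)%:P * Q); rewrite {1}h rmorphN /=; ring.
move/eqXP/(_ n (ltnSn n)); rewrite coefD !coefCM !coef_poly !ltnSn => <-.
by rewrite -exprS.
Qed.
End Umbral.

(** * Translations of symmetric polynomials *)

(** The monomial [a p^l s^m] is stored as [(a, (l, m))]; [s] and [p] stand for the
elementary symmetric functions of two variables and have weights 1 and 2. *)
Definition monom := (int * (nat * nat))%type.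
Definition monom_weight (e : monom) : nat := (2 * e.2.1 + e.2.2)%N.
Definition monom_eval (A : comNzRingType) (s p t : A) n (e : monom) : A :=
  e.1%:~R * p ^+ e.2.1 * s ^+ e.2.2 * t ^+ (n - monom_weight e).

(** Homogeneous expansions are carried as explicit lists of terms valid in every
commutative ring, because the same one is evaluated in two different rings: on
face polynomials and on arguments of the umbral functional. *)
Definition expands n (F : forall A : comNzRingType, A -> A -> A -> A) (r : seq monom) :=
  all (fun e => (monom_weight e <= n)%N) r /\
  forall (A : comNzRingType) (s p t : A), F A s p t = \sum_(e <- r) monom_eval s p t n e.

Definition mul_s (r : seq monom) := [seq (e.1, (e.2.1, e.2.2.+1)) | e <- r].
Definition mul_p (r : seq monom) := [seq (e.1, (e.2.1.+1, e.2.2)) | e <- r].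

Lemma expands_s n F r : expands n F r ->
  expands n.+1 (fun A s p t => s * F A s p t) (mul_s r).
Proof.
case=> /allP ok h; split.
  by rewrite all_map; apply/allP => e /ok /=; rewrite /monom_weight /= addnS.
move=> A s p t; rewrite h big_map mulr_sumr; apply: eq_bigr => e _.
by rewrite /monom_eval /monom_weight /= addnS subSS !exprS; ring.
Qed.

Lemma expands_t n F r : expands n F r ->
  expands n.+1 (fun A s p t => t * F A s p t) r.
Proof.
case=> /allP ok h; split; first by apply/allP => e /ok /=; apply: leqW.
move=> A s p t; rewrite h mulr_sumr !big_seq; apply: eq_bigr => e /ok eok.
by rewrite /monom_eval subSn // exprS; ring.
Qed.

Lemma expands_p n F r : expands n F r ->
  expands n.+2 (fun A s p t => p * F A s p t) (mul_p r).
Proof.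
case=> /allP ok h; split.
  by rewrite all_map; apply/allP => e /ok /=; rewrite /monom_weight /= mulnS addSn.
move=> A s p t; rewrite h big_map mulr_sumr; apply: eq_bigr => e _.
by rewrite /monom_eval /monom_weight /= mulnS addSn !addSn !subSS !exprS; ring.
Qed.

Lemma expands_add n F G r1 r2 : expands n F r1 -> expands n G r2 ->
  expands n (fun A s p t => F A s p t + G A s p t) (r1 ++ r2).
Proof.
case=> ok1 h1 [ok2 h2]; split; first by rewrite all_cat ok1.
by move=> A s p t; rewrite h1 h2 big_cat.
Qed.

Lemma expands_ext n F G r : (forall A s p t, F A s p t = G A s p t) ->
  expands n F r -> expands n G r.
Proof. by move=> e [ok h]; split=> // A s p t; rewrite -e h. Qed.

(** The terms of [(p + t s + t^2)^j (s + 2t)^N], the translate of [p^j s^N]. *)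
Definition translation (N j : nat) : seq monom :=
  iter j (fun r => mul_p r ++ (mul_s r ++ r))
    (iter N (fun r => mul_s r ++ (r ++ r)) [:: (1%R, (0%N, 0%N))]).

Lemma translation_expands N j :
  expands (N + 2 * j)
    (fun A s p t => (p + t * s + t ^+ 2) ^+ j * (s + 2 * t) ^+ N) (translation N j).
Proof.
rewrite /translation; elim: j => [|j IH] /=.
  rewrite muln0 addn0; elim: N => [|N IH] /=.
    by split=> // A s p t; rewrite big_seq1 /monom_eval /= !expr0 !mulr1.
  apply: expands_ext; last first.
    exact: expands_add (expands_s IH) (expands_add (expands_t IH) (expands_t IH)).
  by move=> A s p t /=; rewrite !exprS; ring.
have -> : (N + 2 * j.+1 = (N + 2 * j).+2)%N by lia.
apply: expands_ext; last first.
  exact: expands_add (expands_p IH)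
    (expands_add (expands_t (expands_s IH)) (expands_t (expands_t IH))).
by move=> A s p t /=; rewrite !exprS; ring.
Qed.

(** The polynomial [x^j (1 + x)^(n - 2j)] in the shifted variable ['X = x - 1],
in which face polynomials have the face numbers as coefficients. *)
Definition gamma_basis n j : {poly int} := ('X + 1) ^+ j * ('X + 2) ^+ (n - 2 * j).

(** The operator that takes the face polynomial of a simple [n]-polytope to the
sum of the face polynomials of its [i]-faces. *)
Definition iface_sum n i (p : {poly int}) : {poly int} :=
  \poly_(k < n.+1) (p`_k *+ 'C(n - k, n - i)).

Lemma coef_1X_exp (B : comNzRingType) n i :
  (((1 + 'X) ^+ n : {poly B})`_i) = 'C(n, i)%:R.
Proof.
elim: n i => [|n IH] i; first by rewrite expr0 coef1 bin0n.
rewrite exprS mulrDl mul1r coefD coefXM !IH.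
by case: i => [|i] /=; rewrite ?bin0 ?addr0 // binS natrD.
Qed.

Section Homogenize.
Variables (B : comNzRingType) (u v : B).
Definition homogenize n (p : {poly int}) : B :=
  \sum_(k < n.+1) (p`_k)%:~R * u ^+ k * v ^+ (n - k).

Lemma homogenize_XaddC n (p : {poly int}) c : (size p <= n.+1)%N ->
  homogenize n.+1 (p * ('X + c%:P)) = homogenize n p * (u + c%:~R * v).
Proof.
move=> sp; rewrite /homogenize mulrDr [RHS]mulrDr.
under eq_bigr do rewrite coefD coefMX coefMC rmorphD /= !mulrDl.
rewrite big_split /=; congr (_ + _).
  rewrite big_ord_recl /= !mul0r add0r mulr_suml; apply: eq_bigr => k _.
  by rewrite /bump /= add1n subSS exprS; ring.
rewrite big_ord_recr /= nth_default // mul0r !mul0r addr0 mulr_suml.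
apply: eq_bigr => k _; rewrite subSn ?leq_ord // exprS rmorphM /=; ring.
Qed.

Lemma homogenizeS n (p : {poly int}) : (size p <= n.+1)%N ->
  homogenize n.+1 p = homogenize n p * v.
Proof.
move=> sp; rewrite /homogenize big_ord_recr /= nth_default // !mul0r addr0 mulr_suml.
by apply: eq_bigr => k _; rewrite subSn ?leq_ord // exprS; ring.
Qed.

(** The size bound is part of the induction: [homogenize] is multiplicative only
within the prescribed degree. *)
Lemma homogenize_gamma_basis N j :
  (size (gamma_basis (N + 2 * j) j) <= (N + 2 * j).+1)%N /\
  homogenize (N + 2 * j) (gamma_basis (N + 2 * j) j) =
  ((u + v) * v) ^+ j * (u + 2 * v) ^+ N.
Proof.
rewrite /gamma_basis addnK.
have sXC (p : {poly int}) c n : (size p <= n)%N -> (size (p * ('X + c%:P))%R <= n.+1)%N.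
  move=> h; apply: leq_trans (size_polyMleq _ _) _.
  by rewrite size_XaddC addn2.
elim: j => [|j [s IH]].
  rewrite !expr0 !mul1r muln0 addn0; elim: N => [|N [s IH]].
    split; first by rewrite expr0 size_poly1.
    by rewrite /homogenize big_ord1 coef1 !expr0 !mulr1.
  have two : 2 = 2%:P :> {poly int} by rewrite rmorph_nat.
  rewrite !exprSr {2 4}two; split; first exact: sXC.
  by rewrite homogenize_XaddC // IH.
have -> : (N + 2 * j.+1 = (N + 2 * j).+2)%N by lia.
pose p : {poly int} := ('X + 1) ^+ j * ('X + 2) ^+ N; rewrite -/p in s IH.
have -> : ('X + 1) ^+ j.+1 * ('X + 2) ^+ N = p * ('X + 1%:P) by rewrite exprS /p; ring.
have s' : (size (p * ('X + 1%:P))%R <= (N + 2 * j).+2)%N by apply: sXC.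
by split; [exact: leqW | rewrite homogenizeS // homogenize_XaddC // IH exprS; ring].
Qed.
End Homogenize.

Lemma gamma_basis_lead n j : (2 * j <= n)%N -> (gamma_basis n j)`_n = (j == 0)%N%:R.
Proof.
move=> jn; have := (homogenize_gamma_basis (1 : int) 0 (n - 2 * j) j).2.
rewrite subnK // /homogenize big_ord_recr /= subnn !expr1n !mulr1 big1 => [|k _]; last first.
  by rewrite expr0n subn_eq0 leqNgt ltn_ord mulr0.
rewrite add0r intz => ->; rewrite !mulr0 ?addr0 ?expr1n ?mulr1.
by case: j {jn} => [|j]; rewrite ?expr0 // expr0n.
Qed.

(** With [v = 1 + t] the homogenisation of [gamma_basis n j] becomes a translate
of [p^j s^(n-2j)] at [s = 'X + 2] and [p = 'X + 1]; on the other hand its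
coefficient at [t^(n-i)] is [iface_sum n i]. *)
Lemma iface_sum_gamma_basis n j r i : (2 * j <= n)%N -> (i <= n)%N ->
  expands n (fun A s p t => (p + t * s + t ^+ 2) ^+ j * (s + 2 * t) ^+ (n - 2 * j)) r ->
  iface_sum n i (gamma_basis n j) =
  \sum_(e <- r | monom_weight e == i) e.1 *: gamma_basis i e.2.1.
Proof.
move=> jn ile [/allP ok h].
pose y : {poly {poly int}} := ('X : {poly int})%:P.
have := (homogenize_gamma_basis y (1 + 'X) (n - 2 * j) j).2.
rewrite subnK //.
have -> : (y + (1 + 'X)) * (1 + 'X) = (y + 1) + 'X * (y + 2) + 'X ^+ 2 by ring.
have -> : y + 2 * (1 + 'X) = (y + 2) + 2 * 'X by ring.
rewrite h => /(congr1 (fun p : {poly {poly int}} => p`_(n - i))).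
rewrite /homogenize !coef_sum => e.
transitivity (\sum_(k < n.+1) ((gamma_basis n j)`_k *+ 'C(n - k, n - i)) *: ('X^k : {poly int})).
  by rewrite /iface_sum poly_def.
transitivity (\sum_(k < n.+1)
   (((gamma_basis n j)`_k)%:~R * y ^+ k * (1 + 'X) ^+ (n - k))`_(n - i)).
  apply: eq_bigr => k _; rewrite -rmorphXn /= -[_%:~R](rmorph_int (polyC)) -polyCM coefCM.
  by rewrite coef_1X_exp mulr_natr mulrzl -scaler_int intz scalerMnl.
rewrite {}e [RHS]big_mkcond !big_seq; apply: eq_bigr => e /ok eok.
rewrite /monom_eval /y.
have -> : 'X%:P + 1 = ('X + 1 : {poly int})%:P :> {poly {poly int}} by rewrite rmorphD.
have -> : 'X%:P + 2 = ('X + 2 : {poly int})%:P :> {poly {poly int}} by rewrite rmorphD rmorph_nat.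
rewrite -!rmorphXn /= -[_%:~R](rmorph_int (polyC)) -!polyCM coefCM coefXn.
have -> : (n - i == n - monom_weight e)%N = (monom_weight e == i) by lia.
case: eqP => [<-|_]; last by rewrite mulr0.
by rewrite mulr1 /gamma_basis /monom_weight addKn -mulrA mulrzl -scaler_int intz.
Qed.

(** * The recursion for the polynomials [g_nj] *)
Lemma truncationD n h1 h2 :
  toric_truncation n (h1 + h2) = toric_truncation n h1 + toric_truncation n h2.
Proof.
apply/polyP => i; rewrite coefD !coef_poly; case: ifP => // _.
by case: i => [|i]; rewrite !coefD; ring.
Qed.

Lemma truncationZ n (a : int) h : toric_truncation n (a *: h) = a *: toric_truncation n h.
Proof.
apply/polyP => i; rewrite coefZ !coef_poly; case: ifP => _; last by rewrite mulr0.
by case: i => [|i]; rewrite !coefZ; ring.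
Qed.

Lemma truncation_sum n (I : Type) (r : seq I) (P : pred I) (F : I -> {poly int}) :
  toric_truncation n (\sum_(i <- r | P i) F i) =
  \sum_(i <- r | P i) toric_truncation n (F i).
Proof.
elim/big_rec2: _ => [|i x y _ <-]; last exact: truncationD.
by have := truncationZ n 0 0; rewrite !scale0r.
Qed.

(** Truncation keeps the coefficients of [(1 - x) h] up to degree [n/2].  So [g]
is the truncation as soon as it differs from [(1 - x) h] in higher degrees
only. *)
Lemma truncation_unique n (g h H : {poly int}) : (size g <= n./2.+1)%N ->
  ('X - 1) * h + g = 'X^(n./2.+1) * H -> toric_truncation n h = g.
Proof.
move=> sg e; apply/polyP => i; rewrite coef_poly; case: ltnP => hi; last first.
  by rewrite nth_default // (leq_trans sg).
have := congr1 (fun p : {poly int} => p`_i) e.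
rewrite coefXnM hi coefD mulrBl mul1r coefB coefXM.
case: i hi => [|i] hi /=; first by move/eqP; rewrite sub0r addrC subr_eq0 subr0 => /eqP.
by move/eqP; rewrite addrC addr_eq0 opprB => /eqP.
Qed.

Lemma g_njE n j : (2 * j <= n)%N -> g_nj n j = catalan_sum 1 ('X - 1) n j.
Proof.
move=> jn; rewrite /g_nj (minn_idPl _); last lia.
by apply: eq_bigr => k _; rewrite expr1n mulr1.
Qed.

Lemma size_g_nj n j : (2 * j <= n)%N -> (size (g_nj n j) <= n./2.+1)%N.
Proof.
move=> jn; rewrite g_njE //; apply: leq_trans (size_sum _ _ _) _.
apply/bigmax_leqP => k _; rewrite expr1n mulr1 -scaler_nat mulr_algl.
apply: leq_trans (size_scale_leq _ _) _.
by rewrite -polyC1 size_exp_XsubC ltn_ord.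
Qed.

(** The left-hand side is [x^(n+1) g(1/x)] for a [g] of degree at most [n/2]. *)
Lemma catalan_sum_low_coefs n j (w : {poly int}) :
  exists H : {poly int}, 'X * catalan_sum 'X w n j = 'X^(n./2.+1) * H.
Proof.
exists (\sum_(k < n./2.+1) (catalan (n - k - j) * 'C(n - k, k))%:R * 'X^(n - k - n./2) * w ^+ k).
rewrite !mulr_sumr; apply: eq_bigr => k _.
have -> : (n - k = n - k - n./2 + n./2)%N by have := ltn_ord k; lia.
rewrite addnK exprD exprS; ring.
Qed.

Section Kernel.
Variables (n j : nat) (r : seq monom).
Hypothesis jn : (2 * j <= n)%N.
Hypothesis hr : expands n
  (fun A s p t => (p + t * s + t ^+ 2) ^+ j * (s + 2 * t) ^+ (n - 2 * j)) r.
Let q : {poly int} := 'X - 1.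
Local Notation L0 := (umbral (fun a => catalan_sum 1 q a 0)).

Lemma L0_monom (t : {poly int}) (e : monom) :
  L0 (monom_eval 'X ('X + q%:P) t%:P n e) =
  e.1 *: (g_nj (monom_weight e) e.2.1 * t ^+ (n - monom_weight e)).
Proof.
rewrite g_njE ?leq_addr // /monom_weight addnC catalan_sum_umbral polyC1 !mul1r addnC.
have -> : monom_eval 'X ('X + q%:P) t%:P n e =
    (e.1%:~R * t ^+ (n - monom_weight e))%:P * ('X^(e.2.2) * ('X + q%:P) ^+ e.2.1).
  by rewrite /monom_eval -[e.1%:~R](rmorph_int polyC) rmorphM rmorphXn /=; ring.
by rewrite umbralC -[X in X *: _]intz scaler_int -[RHS]mulrzl -mulrA; congr (_ * _); rewrite mulrC.
Qed.

(** The terms without [t] form [p^j s^(n-2j)] itself. *)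
Lemma g_nj_diagonal : \sum_(e <- r | monom_weight e == n) e.1 *: g_nj n e.2.1 = g_nj n j.
Proof.
case: hr => /allP ok /(_ _ 'X ('X + q%:P) 0%:P) /(congr1 L0).
have -> : g_nj n j = L0 ('X^(n - 2 * j) * ('X + q%:P) ^+ j).
  by rewrite g_njE // -{1}(subnK jn) catalan_sum_umbral polyC1 !mul1r.
rewrite linear_sum /= polyC0 !mul0r expr0n /= !addr0 mulr0 addr0 mulrC => ->.
rewrite big_mkcond !big_seq; apply: eq_bigr => e /ok eok.
rewrite -polyC0 L0_monom expr0n subn_eq0.
case: eqP => [->|ne]; first by rewrite leqnn mulr1.
by rewrite (_ : (n <= _)%N = false) ?mulr0 ?scaler0 //; lia.
Qed.

(** At [p = s + q] and [t = q] the translate of [p^j s^(n-2j)] factors as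
[x^j (s + q)^j (s + 2q)^(n-2j)], which is [x^j phi(s + 2q)] for
[phi = s^(n-2j) (s - q)^j].  By linearity [cube_identity] applies to [phi], and
its correction term [phi(q)] vanishes unless [j = 0]. *)
Lemma kernel_sum :
  \sum_(e <- r) e.1 *: (g_nj (monom_weight e) e.2.1 * q ^+ (n - monom_weight e)) +
  (j == 0%N)%:R * q ^+ n.+1 = 'X * catalan_sum 'X (- q) n j.
Proof.
have X1 : 1 + q = 'X by rewrite /q; ring.
case: hr => _ /(_ _ 'X ('X + q%:P) q%:P) /(congr1 L0).
rewrite linear_sum /=; under [X in _ = X]eq_bigr do rewrite L0_monom.
move=> <-.
pose phi : {poly {poly int}} := 'X^(n - 2 * j) * ('X - q%:P) ^+ j.
have -> : ('X + q%:P + q%:P * 'X + q%:P ^+ 2) ^+ j * ('X + 2 * q%:P) ^+ (n - 2 * j) =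
   ('X ^+ j)%:P * (phi \Po ('X + (2 * q)%:P)).
  rewrite /phi comp_polyM comp_Xn_poly !rmorphXn /= comp_polyB comp_polyX comp_polyC.
  have -> : ('X : {poly int})%:P = 1 + q%:P by rewrite /q rmorphB /=; ring.
  have -> : (2 * q)%:P = 2 * q%:P by rewrite rmorphM rmorph_nat.
  by rewrite [RHS]mulrCA -exprMn [LHS]mulrC; congr (_ * _ ^+ _); ring.
have cube_linear (p : {poly {poly int}}) : L0 (p \Po ('X + (2 * q)%:P)) + q * p.[q] =
    'X * umbral (fun a => catalan_sum 'X (- q) a 0) p.
  rewrite comp_polyE linear_sum horner_coef mulr_sumr -big_split /umbral mulr_sumr.
  apply: eq_bigr => i _ /=; rewrite linearZ /= -mulrCA -exprS mulrCA -mulrDr cube_identity.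
  by rewrite X1 mulrCA.
have -> : catalan_sum 'X (- q) n j = 'X ^+ j * umbral (fun a => catalan_sum 'X (- q) a 0) phi.
  rewrite -umbralC -{1}(subnK jn) catalan_sum_umbral; congr umbral.
  rewrite /phi rmorphXn /= mulrCA -exprMn; congr (_ * _ ^+ _).
  by rewrite mulrN rmorphN rmorphM /=; ring.
rewrite mulrCA -cube_linear umbralC [RHS]mulrDr; congr (_ + _).
rewrite /phi hornerM hornerXn horner_exp hornerXsubC subrr.
case: (posnP j) => [->|j0]; last by rewrite expr0n gtn_eqF // !mulr0 mul0r.
by rewrite muln0 subn0 !expr0 mulr1 !mul1r exprS.
Qed.

(** This is the recursion for [g] on the basis element number [j]: the term with
[j = 0] is the contribution of the empty face, and the sum that of the proper
nonempty faces. *)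
Lemma truncation_kernel :
  toric_truncation n ((j == 0%N)%:R * q ^+ n +
    \sum_(e <- r | (monom_weight e < n)%N)
      e.1 *: (g_nj (monom_weight e) e.2.1 * q ^+ (n.-1 - monom_weight e))) = g_nj n j.
Proof.
have [H hH] := catalan_sum_low_coefs n j (- q).
apply: (@truncation_unique _ _ _ H); first exact: size_g_nj.
rewrite -hH -kernel_sum -/q mulrDr mulr_sumr -g_nj_diagonal.
rewrite [in RHS](bigID (fun e => monom_weight e < n)%N) /= mulrCA -exprS.
rewrite -addrA addrC; congr (_ + _).
congr (_ + _).
  apply: eq_bigr => e en; rewrite -scalerAr mulrCA -exprS; congr (_ *: (_ * _ ^+ _)); lia.
case: hr => /allP ok _; rewrite big_seq_cond [RHS]big_seq_cond; apply: eq_big => e; last first.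
  by move/andP=> [_ /eqP ->]; rewrite subnn expr0 mulr1.
by apply: andb_id2l => /ok; lia.
Qed.
End Kernel.

(** * Ranked posets with Boolean upper intervals *)
Section RankedPoset.
Variables (disp : Order.disp_t) (L : finTBPOrderType disp) (rk : L -> nat).
Implicit Types x y z w : L.
Hypothesis rk_lt : forall x y, (x < y)%O -> (rk x < rk y)%N.
Hypothesis rk0 : rk \bot%O = 0%N.
Hypothesis rk_gap : forall x y, (x <= y)%O -> ((rk x).+2 <= rk y)%N ->
  exists z1 z2, [/\ (x < z1 < y)%O, (x < z2 < y)%O &
    forall w, (w <= z1)%O -> (w <= z2)%O -> (w <= x)%O].

Lemma rk_le x y : (x <= y)%O -> (rk x <= rk y)%N.
Proof. by rewrite le_eqVlt => /predU1P[->//|/rk_lt/ltnW]. Qed.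

Lemma rk_le_eq x y : (x <= y)%O -> rk x = rk y -> x = y.
Proof. by rewrite le_eqVlt => /predU1P[//|/rk_lt lt e]; rewrite e ltnn in lt. Qed.

Lemma cocover x y : (x < y)%O -> exists2 z, (x <= z < y)%O & (rk z).+1 = rk y.
Proof.
move=> xy; pose z := [arg max_(z > x | (x <= z < y)%O) rk z]; exists z.
  by rewrite /z; case: arg_maxnP => //; rewrite lexx xy.
rewrite /z; case: arg_maxnP => [|w /andP[xw wy] wmax]; first by rewrite lexx xy.
have := rk_lt wy; rewrite leq_eqVlt => /predU1P[//|lt].
have [z1 [_ [/andP[wz zy] _ _]]] := rk_gap (ltW wy) lt.
have := wmax z1; rewrite zy (le_trans xw (ltW wz)) => /(_ isT).
by rewrite /= leqNgt rk_lt.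
Qed.

Lemma cover x y : (x < y)%O -> exists2 z, (x < z <= y)%O & rk z = (rk x).+1.
Proof.
move=> xy; pose z := [arg min_(z < y | (x < z <= y)%O) rk z]; exists z.
  by rewrite /z; case: arg_minnP => //; rewrite lexx xy.
rewrite /z; case: arg_minnP => [|w /andP[xw wy] wmin]; first by rewrite lexx xy.
have := rk_lt xw; rewrite leq_eqVlt => /predU1P[//|lt].
have [z1 [_ [/andP[xz zw] _ _]]] := rk_gap (ltW xw) lt.
have := wmin z1; rewrite xz (le_trans (ltW zw) wy) => /(_ isT).
by rewrite /= leqNgt rk_lt.
Qed.

Lemma rk_gt0 x : (0 < rk x)%N = (x != \bot%O).
Proof.
have [->|x0] := eqVneq x \bot%O; first by rewrite rk0.
by rewrite -rk0 rk_lt // lt0x.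
Qed.

Lemma poset_rankE y : poset_rank y = rk y.
Proof.
apply/eqP; rewrite eqn_leq; apply/andP; split.
  apply/bigmax_leqP => C /forall_inP chC.
  have Crk a : a \in C -> (rk a < rk y)%N by move=> /chC /andP[/rk_lt].
  have inj : {in C &, injective (fun a => inord (rk a) : 'I_(rk y).-1.+1)}.
    move=> a b aC bC /(congr1 val); rewrite /= !inordK ?prednK ?Crk //;
      try exact: leq_ltn_trans (Crk _ aC).
    have /andP[_ /forall_inP/(_ _ bC)] := chC _ aC => /orP[] le e; last apply/esym.
      exact: rk_le_eq.
    by apply: rk_le_eq.
  have [->|[c cC]] := set_0Vmem C; first by rewrite cards0.
  rewrite -(card_in_imset inj) (leq_trans (max_card _)) // card_ord prednK //.
  exact: leq_ltn_trans (Crk _ cC).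
move: {2}(rk y) (erefl (rk y)) => k; elim: k y => [|k IH] y e; first by rewrite e.
have y0 : (\bot < y)%O by rewrite lt0x -rk_gt0 e.
have [z /andP[_ zy]] := cocover y0; rewrite e => -[ez].
by apply: leq_ltn_trans (poset_rank_lt zy); rewrite -[X in (X <= _)%N]ez IH.
Qed.

Section Simple.
Variable n : nat.
Hypothesis rk1 : rk \top%O = n.+1.

Definition coatoms_above x : {set L} := [set a | (rk a == n) && (x <= a)%O].
Hypothesis simple : forall v, rk v = 1%N -> #|coatoms_above v| = n.

(** An element of corank at least two is the meet of two larger ones, hence by
descending induction the meet of the coatoms above it. *)
Lemma coatoms_aboveS x y : (x <= y)%O = (coatoms_above y \subset coatoms_above x).
Proof.
apply/idP/idP => [xy|].
  by apply/subsetP => a; rewrite !inE => /andP[-> /(le_trans xy)].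
move: {2}(n.+1 - rk y)%N (leqnn (n.+1 - rk y)) => k; elim: k y => [|k IH] y.
  rewrite leqn0 subn_eq0 => h _; suff -> : y = \top%O by exact: lex1.
  by apply: rk_le_eq (lex1 y) _; apply/eqP; rewrite eqn_leq rk1 h -rk1 rk_le ?lex1.
move=> hk sub; have := rk_le (lex1 y); rewrite rk1 leq_eqVlt => /predU1P[e|].
  by apply: IH => //; rewrite e subnn.
rewrite ltnS leq_eqVlt => /predU1P[e|lt].
  have : y \in coatoms_above y by rewrite inE e eqxx lexx.
  by move/(subsetP sub); rewrite inE => /andP[].
have [||z1 [z2 [/andP[y1 _] /andP[y2 _]]]] := @rk_gap y \top%O; rewrite ?lex1 ?rk1 //.
have step z : (y < z)%O -> (x <= z)%O.
  move=> yz; apply: IH; first by have := rk_lt yz; lia.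
  apply: subset_trans sub; apply/subsetP => a; rewrite !inE => /andP[-> za].
  exact: le_trans (ltW yz) za.
by apply; exact: step.
Qed.

Lemma coatoms_above_inj : injective coatoms_above.
Proof.
by move=> x y e; apply/eqP; rewrite eq_le !coatoms_aboveS e subxx.
Qed.

Lemma coatoms_above_proper x y : (x < y)%O -> coatoms_above y \proper coatoms_above x.
Proof.
rewrite lt_neqAle coatoms_aboveS properEneq => /andP[ne ->]; rewrite andbT.
by apply: contra ne => /eqP/coatoms_above_inj ->.
Qed.

(** The set of coatoms shrinks strictly along a chain.  Going up to the maximum
it loses at least one element per step, and going down to an atom it gains at
least one per step; over the atom there are [n], so each step changes exactly
one coatom. *)
Lemma card_coatoms_above x : x != \bot%O -> #|coatoms_above x| = (n.+1 - rk x)%N.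
Proof.
move=> x0; have le1 y : (rk y <= n.+1)%N by rewrite -rk1 rk_le ?lex1.
apply/eqP; rewrite eqn_leq; apply/andP; split.
  move: {2}(rk x) (erefl (rk x)) => k; elim: k x x0 => [|k IH] x x0 e.
    by move: x0; rewrite -rk_gt0 e.
  case: k IH e => [|k] IH e; first by rewrite simple // e subn1.
  have [|z /andP[_ zx] ez] := @cocover \bot%O x; first by rewrite lt0x.
  have z0 : z != \bot%O by rewrite -rk_gt0; lia.
  have := proper_card (coatoms_above_proper zx).
  have := IH z z0; rewrite (_ : rk z = k.+1); last lia.
  move=> /(_ erefl); lia.
move: {2}(n.+1 - rk x)%N (erefl (n.+1 - rk x)%N) => k.
elim: k x {x0} => [|k IH] x e; first by rewrite e.
have xt : (x < \top)%O by rewrite ltx1; apply/eqP => h; move: e; rewrite h rk1; lia.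
have [z /andP[xz _] ez] := cover xt.
have := proper_card (coatoms_above_proper xz); have := IH z; lia.
Qed.

Lemma coatoms_above_cover x z : x != \bot%O -> (x < z)%O -> rk z = (rk x).+1 ->
  exists2 a, a \in coatoms_above x & coatoms_above z = coatoms_above x :\ a.
Proof.
move=> x0 xz ez; have /properP[sub [a ax az]] := coatoms_above_proper xz.
have z0 : z != \bot%O by rewrite -rk_gt0 ez.
exists a => //; apply/eqP; rewrite eqEcard subsetD1 sub az /=.
have := cardsD1 a (coatoms_above x); rewrite ax !card_coatoms_above // ez /=; lia.
Qed.

(** It suffices to remove a single coatom [b].  Some cover [z] of [x] removes some
[a].  If [a] is not [b], the induction hypothesis at [z] yields [t], of rank two
above [x], which removes both; an element between [x] and [t] other than [z]
removes [b] alone. *)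
Lemma coatoms_above_onto x (S : {set L}) : x != \bot%O -> S \subset coatoms_above x ->
  exists z, coatoms_above z = S.
Proof.
move: {2}(n.+1 - rk x)%N (erefl (n.+1 - rk x)%N) => k.
elim: k x S => [|k IH] x S e x0 sub.
  exists x; apply/eqP; rewrite eq_sym eqEcard sub card_coatoms_above // e.
  by [].
have [->|ne] := eqVneq S (coatoms_above x); first by exists x.
have /properP[_ [b bx bS]] : S \proper coatoms_above x by rewrite properEneq ne sub.
have above_x z : coatoms_above z \subset coatoms_above x -> z != \bot%O.
  by rewrite -coatoms_aboveS => xz; apply: contra x0 => /eqP h; rewrite -lex0 -h.
suff [z ez] : exists z, coatoms_above z = coatoms_above x :\ b.
  have z0 : z != \bot%O by rewrite above_x // ez subD1set.
  apply: (IH z) => //; last by rewrite ez subsetD1 sub.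
  by have := cardsD1 b (coatoms_above x); rewrite bx -ez !card_coatoms_above //=; lia.
have xt : (x < \top)%O by rewrite ltx1; apply/eqP => h; move: e; rewrite h rk1; lia.
have [z /andP[xz _] ez] := cover xt.
have z0 : z != \bot%O by rewrite -rk_gt0 ez.
have [a ax za] := coatoms_above_cover x0 xz ez.
have [ab|ab] := eqVneq a b; first by exists z; rewrite za ab.
have [t et] : exists t, coatoms_above t = coatoms_above x :\ a :\ b.
  by apply: (IH z); rewrite ?za ?subD1set //; move: e; rewrite ez; clear; lia.
have tsub : coatoms_above t \subset coatoms_above x.
  by rewrite et (subset_trans (subD1set _ _)) ?subD1set.
have xt' : (x <= t)%O by rewrite coatoms_aboveS.
have t0 := above_x _ tsub.
have ert : rk t = (rk x).+2.
  have arith r1 r2 m : (r2 <= n.+1 -> n.+1 - r1 = 1 + m -> m = 1 + (n.+1 - r2) -> r2 = r1.+2)%N.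
    by clear; lia.
  apply: (arith _ _ #|coatoms_above x :\ a|); first by rewrite -rk1 rk_le ?lex1.
    by rewrite -card_coatoms_above // (cardsD1 a) ax.
  by rewrite -card_coatoms_above // (cardsD1 b) in_setD1 eq_sym ab bx et.
have [|u [v [/andP[xu ut] /andP[xv vt] uv]]] := @rk_gap x t xt'; first by rewrite ert.
have [w /andP[xw wt] wz] : exists2 w, (x < w < t)%O & w != z.
  have [uz|] := eqVneq u z; last by exists u; rewrite ?xu.
  exists v; rewrite ?xv //; apply/eqP => vz.
  by have := uv z; rewrite uz vz lexx => /(_ isT isT); rewrite lt_geF.
have ew : rk w = (rk x).+1 by apply/eqP; rewrite eqn_leq -[X in X && _]ltnS -ert !rk_lt.
have [c cx wc] := coatoms_above_cover x0 xw ew.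
have : coatoms_above t \subset coatoms_above w by rewrite -coatoms_aboveS ltW.
have [cb|cb] := eqVneq c b; first by exists w; rewrite wc cb.
have [ca|ca] := eqVneq c a.
  by case/eqP: wz; apply: coatoms_above_inj; rewrite wc za ca.
by rewrite et wc => /subsetP/(_ c); rewrite !in_setD1 cb ca cx eqxx => /(_ isT).
Qed.

(** The elements between [x] and [y] correspond to the sets of coatoms between
those of [y] and those of [x]. *)
Lemma card_between x y i : x != \bot%O -> (x <= y)%O -> (i <= rk y)%N ->
  #|[set z | (x <= z <= y)%O && (rk z == i)]| = 'C(rk y - rk x, rk y - i).
Proof.
move=> x0 xy iy; have y0 : y != \bot%O by apply: contra x0 => /eqP h; rewrite -lex0 -h.
have ry : (rk y <= n.+1)%N by rewrite -rk1 rk_le ?lex1.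
have sub : coatoms_above y \subset coatoms_above x by rewrite -coatoms_aboveS.
have <- : #|coatoms_above x :\: coatoms_above y| = (rk y - rk x)%N.
  have := cardsID (coatoms_above y) (coatoms_above x).
  rewrite (setIidPr sub) !card_coatoms_above //; have := rk_le xy; lia.
rewrite -cards_draws -(card_imset _ coatoms_above_inj).
have inj : {in [set T : {set L} | coatoms_above y \subset T] &,
    injective (fun T => T :\: coatoms_above y)}.
  move=> T1 T2; rewrite !inE => s1 s2 e.
  by rewrite -(setID T1 (coatoms_above y)) -(setID T2 (coatoms_above y)) e
    (setIidPr s1) (setIidPr s2).
rewrite -(card_in_imset (D := mem (coatoms_above @: _))
  (f := fun T => T :\: coatoms_above y)); last first.
  move=> T1 T2 /imsetP[z1]; rewrite inE => /andP[/andP[_ h1] _ ->].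
  move=> /imsetP[z2]; rewrite inE => /andP[/andP[_ h2] _ ->].
  by apply: inj; rewrite inE -coatoms_aboveS.
congr #|pred_of_set _|; apply/setP => T; rewrite [RHS]inE; apply/imsetP/andP.
  case=> T' /imsetP[z]; rewrite inE => /andP[/andP[xz zy] /eqP ri] -> ->; split.
    by rewrite setSD // -coatoms_aboveS.
  have z0 : z != \bot%O by apply: contra x0 => /eqP h; rewrite -lex0 -h.
  rewrite cardsD (setIidPr _) -?coatoms_aboveS // !card_coatoms_above // ri.
  apply/eqP; lia.
case=> Tsub /eqP cT.
have dis : [disjoint T & coatoms_above y].
  by move: Tsub; rewrite subsetD => /andP[].
have TU : T :|: coatoms_above y \subset coatoms_above x.
  by rewrite subUset sub (subset_trans Tsub) ?subsetDl.
have [z ez] := coatoms_above_onto x0 TU.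
have xz : (x <= z)%O by rewrite coatoms_aboveS ez.
have z0 : z != \bot%O by apply: contra x0 => /eqP h; rewrite -lex0 -h.
exists (T :|: coatoms_above y); last first.
  by rewrite setDUl setDv setU0 (setDidPl _).
rewrite -ez; apply: imset_f; rewrite inE xz coatoms_aboveS ez subsetUr /=.
have := cardsU T (coatoms_above y); rewrite -ez (disjoint_setI0 dis) cards0 subn0.
rewrite !card_coatoms_above // cT; have := rk_le (lex1 z); rewrite rk1.
move=> *; apply/eqP; lia.
Qed.

End Simple.
End RankedPoset.

(** * Toric polynomials of simple ranked posets *)
Fact iface_sum_is_linear n i : linear (iface_sum n i).
Proof.
move=> a p r; apply/polyP => k; rewrite coefD coefZ !coef_poly.
case: ifP => _; last by rewrite mulr0 addr0.
by rewrite coefD coefZ mulrnDl mulrnAr.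
Qed.
HB.instance Definition _ n i :=
  GRing.isLinear.Build int {poly int} {poly int} *:%R (iface_sum n i) (iface_sum_is_linear n i).

Lemma iface_sumX n i k : (k <= n)%N -> iface_sum n i 'X^k = 'X^k *+ 'C(n - k, n - i).
Proof.
move=> kn; apply/polyP => l; rewrite coef_poly coefMn coefXn.
case: eqP => [->|_]; first by rewrite ltnS kn.
by rewrite !mul0rn if_same.
Qed.

Section ToricG.
Variables (disp : Order.disp_t) (L : finTBPOrderType disp) (rk : L -> nat).
Implicit Types x y z w : L.
Hypothesis rk_lt : forall x y, (x < y)%O -> (rk x < rk y)%N.
Hypothesis rk0 : rk \bot%O = 0%N.
Hypothesis rkE : forall y, poset_rank y = rk y.
Hypothesis card_between : forall x y i, x != \bot%O -> (x <= y)%O -> (i <= rk y)%N ->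
  #|[set z | (x <= z <= y)%O && (rk z == i)]| = 'C(rk y - rk x, rk y - i).

(** The exponents are the dimensions: the rank of a face is its dimension plus
one. *)
Definition face_poly y : {poly int} :=
  \sum_(z | (z != \bot%O) && (z <= y)%O) 'X^((rk z).-1).

Let rk_pos x : x != \bot%O -> (0 < rk x)%N.
Proof. by rewrite (rk_gt0 rk_lt rk0). Qed.

Lemma face_poly_lead n y : rk y = n.+1 -> (face_poly y)`_n = 1.
Proof.
move=> ry; have y0 : y != \bot%O by apply/eqP => h; move: ry; rewrite h rk0.
rewrite coef_sum (bigD1 y) ?y0 ?lexx //= coefXn ry eqxx big1 ?addr0 // => z.
case/andP=> /andP[z0 zy] ne; rewrite coefXn.
have /rk_lt : (z < y)%O by rewrite lt_neqAle ne.
have := rk_pos z0; case: eqP => //; lia.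
Qed.

(** Exchange the sums over [z] and over the elements [w] below [z], and count the
[z] over a given [w]. *)
Lemma iface_sum_face_poly n i y : rk y = n.+1 -> (i <= n)%N ->
  iface_sum n i (face_poly y) = \sum_(z | (rk z == i.+1) && (z <= y)%O) face_poly z.
Proof.
move=> ry ile; rewrite linear_sum /= /face_poly.
rewrite [RHS](exchange_big_dep (fun w => (w != \bot%O) && (w <= y)%O)) /=; last first.
  by move=> z w /andP[_ zy] /andP[-> /le_trans ->].
apply: eq_bigr => w /andP[w0 wy].
have := rk_pos w0; have : (rk w <= rk y)%N.
  by move: wy; rewrite le_eqVlt => /predU1P[->//|/rk_lt/ltnW].
rewrite ry => h1 h2; rewrite iface_sumX; last lia.
rewrite sumr_const; congr (_ *+ _).
have -> : 'C(n - (rk w).-1, n - i) = 'C(rk y - rk w, rk y - i.+1).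
  by rewrite ry; congr 'C(_, _); lia.
rewrite -card_between // ?ry //.
apply: eq_card => z; rewrite !inE unfold_in w0 /=.
by case: (w <= z)%O; case: (z <= y)%O; case: (rk z == _).
Qed.

Lemma face_poly_top n : rk \top%O = n.+1 ->
  face_poly \top%O = \sum_(i < n.+1) #|[set z | rk z == i.+1]|%:R * 'X^i.
Proof.
move=> rk1; rewrite /face_poly.
have rkle z : (rk z <= n.+1)%N.
  by rewrite -rk1; have := lex1 z; rewrite le_eqVlt => /predU1P[->//|/rk_lt/ltnW].
have rkpred z : (0 < rk z)%N -> ((rk z).-1 < n.+1)%N by move=> z0; rewrite prednK.
rewrite (partition_big (fun z => inord (rk z).-1 : 'I_n.+1) xpredT) //=.
apply: eq_bigr => i _; rewrite mulr_natl -sumr_const; apply: eq_big => z.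
  rewrite inE lex1 andbT; apply/idP/idP.
    case/andP=> /rk_pos z0 /eqP <-.
    by rewrite inordK ?rkpred // prednK // eqxx.
  move=> /eqP rz; rewrite rz inord_val eqxx andbT.
  by apply/eqP => h; move: rz; rewrite h rk0.
case/andP=> /andP[/rk_pos z0 _] /eqP <-.
by rewrite inordK // rkpred.
Qed.

Lemma toric_g_rank_sum n y : rk y = n.+1 ->
  toric_g_interval y = toric_truncation n (('X - 1) ^+ n +
   \sum_(i < n) (\sum_(z | (rk z == i.+1) && (z <= y)%O) toric_g_interval z)
       * ('X - 1) ^+ (n.-1 - i)).
Proof.
move=> ry; have y0 : y != \bot%O by apply/eqP => h; move: ry; rewrite h rk0.
rewrite toric_g_intervalE (negbTE y0) /toric_f_interval (negbTE y0) rkE ry /=.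
congr toric_truncation; rewrite (bigD1 \bot%O) /= ?lt0x //; congr (_ + _).
  by rewrite toric_g_intervalE eqxx mul1r rkE rk0 subn0.
have zbound z : (z < y)%O && (z != \bot%O) -> ((rk z).-1 < n)%N.
  case/andP=> /rk_lt h /rk_pos; lia.
case: n ry zbound => [|n] ry zbound.
  by rewrite big_ord0 big1 // => z /zbound.
rewrite (partition_big (fun z => inord (rk z).-1 : 'I_n.+1) xpredT) //=.
apply: eq_bigr => i _; rewrite mulr_suml; apply: eq_big => z.
  apply/idP/idP.
    case/andP=> h /eqP <-; rewrite inordK ?zbound //.
    by case/andP: h => /ltW -> /rk_pos; rewrite andbT; lia.
  case/andP=> /eqP rz zy; rewrite lt_neqAle zy andbT.
  have -> : z != \bot%O by apply/eqP => h; move: rz; rewrite h rk0.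
  rewrite rz /= inord_val eqxx !andbT; apply/eqP => h; move: rz; rewrite h ry.
  by have := ltn_ord i; lia.
case/andP=> h /eqP <-; rewrite inordK ?zbound // rkE.
by case/andP: h => _ /rk_pos ?; congr (_ * _ ^+ _); lia.
Qed.

(** For [lam] concentrated on a single element this expands its toric
[g]-polynomial.  The induction needs arbitrary weights, since an element [z] of
lower rank enters with the total weight [mu z] of the elements above it, and
only the weighted sum of face polynomials is known to be symmetric. *)
Lemma gamma_expansion n (lam : L -> int) (s : seq (int * nat)) :
  all (fun e => 2 * e.2 <= n)%N s ->
  \sum_(y | rk y == n.+1) lam y *: face_poly y = \sum_(e <- s) e.1 *: gamma_basis n e.2 ->
  \sum_(y | rk y == n.+1) lam y *: toric_g_interval y = \sum_(e <- s) e.1 *: g_nj n e.2.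
Proof.
elim/ltn_ind: n lam s => n IH lam s /allP sn hlam.
pose q : {poly int} := 'X - 1.
pose tr j := translation (n - 2 * j) j.
have htr j : (2 * j <= n)%N -> expands n
  (fun A s p t => (p + t * s + t ^+ 2) ^+ j * (s + 2 * t) ^+ (n - 2 * j)) (tr j).
  by move=> jn; have := translation_expands (n - 2 * j) j; rewrite subnK.
(* The empty face contributes [q ^+ n] for each [y]; the total weight of the [y]
   is the leading coefficient of the weighted face polynomial. *)
have lead : \sum_(y | rk y == n.+1) lam y = \sum_(e <- s) e.1 * (e.2 == 0)%N%:R.
  have := congr1 (fun p : {poly int} => p`_n) hlam; rewrite !coef_sum.
  under eq_bigr => y /eqP ry do rewrite coefZ face_poly_lead // mulr1.
  by move=> ->; rewrite !big_seq; apply: eq_bigr => e /sn en; rewrite coefZ gamma_basis_lead.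
pose si i := flatten [seq [seq (e.1 * f.1, f.2.1) | f <- tr e.2 & monom_weight f == i] | e <- s].
have sum_si i (V : lmodType int) (F : nat -> V) : \sum_(e <- si i) e.1 *: F e.2 =
    \sum_(e <- s) e.1 *: \sum_(f <- tr e.2 | monom_weight f == i) f.1 *: F f.2.1.
  rewrite big_flatten big_map; apply: eq_bigr => e _.
  by rewrite big_map big_filter scaler_sumr; apply: eq_bigr => f _; rewrite scalerA.
pose mu z := \sum_(y | (rk y == n.+1) && (z <= y)%O) lam y.
have exch i (V : lmodType int) (F : L -> V) :
    \sum_(z | rk z == i.+1) mu z *: F z =
    \sum_(y | rk y == n.+1) lam y *: \sum_(z | (rk z == i.+1) && (z <= y)%O) F z.
  under eq_bigr do rewrite scaler_suml.
  rewrite (exchange_big_dep (fun y => rk y == n.+1)) /=; last by move=> ? ? _ /andP[].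
  by apply: eq_bigr => y ry; rewrite scaler_sumr; apply: eq_bigl => z; rewrite ry.
have below i : (i < n)%N -> \sum_(z | rk z == i.+1) mu z *: toric_g_interval z =
    \sum_(e <- s) e.1 *: \sum_(f <- tr e.2 | monom_weight f == i) f.1 *: g_nj i f.2.1.
  move=> lt; rewrite -(sum_si i _ (g_nj i)); apply: IH => //.
    apply/allP => e1 /flattenP[l /mapP[e es ->]] /mapP[f].
    by rewrite mem_filter => /andP[/eqP <- _] ->; rewrite /= /monom_weight leq_addr.
  rewrite (sum_si i _ (gamma_basis i)) exch.
  have := congr1 (iface_sum n i) hlam; rewrite !linear_sum /=.
  under eq_bigr => y /eqP ry do rewrite linearZ /= (iface_sum_face_poly ry (ltnW lt)).
  move=> ->; rewrite !big_seq; apply: eq_bigr => e /sn en.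
  by rewrite linearZ /= (iface_sum_gamma_basis en (ltnW lt) (htr _ en)).
transitivity (toric_truncation n ((\sum_(y | rk y == n.+1) lam y) *: q ^+ n +
  \sum_(i < n) (\sum_(z | rk z == i.+1) mu z *: toric_g_interval z) * q ^+ (n.-1 - i))).
  rewrite truncationD scaler_suml !truncation_sum.
  under [X in _ + X]eq_bigr do rewrite exch mulr_suml truncation_sum.
  rewrite exchange_big /= -big_split; apply: eq_bigr => y /eqP ry /=.
  rewrite (toric_g_rank_sum ry) truncationD scalerDr truncationZ; congr (_ + _).
  rewrite truncation_sum scaler_sumr; apply: eq_bigr => i _.
  by rewrite -truncationZ scalerAl.
rewrite lead scaler_suml.
under [X in _ + X]eq_bigr => i _ do rewrite below // mulr_suml.
rewrite exchange_big /= -big_split truncation_sum !big_seq; apply: eq_bigr => e /sn en /=.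
rewrite -(truncation_kernel en (htr _ en)) -truncationZ; congr toric_truncation.
rewrite scalerDr; congr (_ + _).
  by rewrite -scalerA scaler_nat mulr_natl.
under eq_bigr do rewrite -scalerAl.
rewrite -scaler_sumr; congr (_ *: _).
case: n {IH sn hlam htr lead si sum_si mu exch below} tr en => [|n] tr en.
  by rewrite big_ord0 big_pred0.
rewrite [RHS](partition_big (fun f : monom => inord (monom_weight f) : 'I_n.+1) xpredT) //=.
apply: eq_bigr => i _; rewrite mulr_suml; apply: eq_big => f.
  apply/idP/idP => [/eqP fi|/andP[lt /eqP <-]]; last by rewrite inordK.
  by rewrite fi ltn_ord inord_val eqxx.
by move=> /eqP <-; rewrite scalerAl.
Qed.
End ToricG.

(** * The face lattice of a polytope *)
Lemma separating_functional (K : fieldType) (m : nat) (U : {vspace 'rV[K]_m}) (u : 'rV[K]_m) :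
  u \notin U -> exists c : 'cV[K]_m,
    (forall v, v \in U -> (v *m c) 0 0 = 0) /\ (u *m c) 0 0 != 0.
Proof.
move=> uU; pose f := (\1 - projv U)%VF : 'End('rV[K]_m).
have fE v : f v = v - projv U v by rewrite add_lfunE opp_lfunE id_lfunE.
have : f u != 0.
  by rewrite fE subr_eq0; apply: contra uU => /eqP ->; apply: memv_proj.
case/rV0Pn => j fj; exists (col j (lin1_mx f)).
have cE v : (v *m col j (lin1_mx f)) 0 0 = f v 0 j.
  by rewrite -mul_rV_lin1 !mxE; apply: eq_bigr => k _; rewrite !mxE.
by split=> [v vU|]; rewrite cE // fE projv_id // subrr mxE.
Qed.

Section Geometry.
Variables (R : realType) (d : nat) (P : polytope R d) (V : seq 'rV[R]_d).
Hypothesis PV : P = convex_hull V :> set 'rV[R]_d.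
Implicit Types F G : face_lattice P.

Local Notation idx := 'I_(size V).

(** Lifting points to height one turns affine functionals into linear ones and
affine dimension plus one into linear dimension, which also gives the empty
face the rank zero. *)
Definition lifted (i : idx) : 'rV[R]_(d + 1) := row_mx V`_i 1%:M.
Definition value (c : 'cV[R]_(d + 1)) (i : idx) : R := (lifted i *m c) 0 0.

Lemma value_col (a : 'cV[R]_d) (b : 'M[R]_1) i :
  value (col_mx a b) i = (V`_i *m a) 0 0 + b 0 0.
Proof. by rewrite /value mul_row_col mul1mx mxE. Qed.

Lemma valueD c1 c2 i : value (c1 + c2) i = value c1 i + value c2 i.
Proof. by rewrite /value mulmxDr mxE. Qed.
Lemma valueN c i : value (- c) i = - value c i.
Proof. by rewrite /value mulmxN mxE. Qed.
Lemma valueZ a c i : value (a *: c) i = a * value c i.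
Proof. by rewrite /value -scalemxAr mxE. Qed.

(** A face is determined by the generating points that it contains; inclusion and
rank of faces are read off these finite sets. *)
Definition generators F : {set idx} := [set i : idx | `[< (val F) V`_i >]]%SET.

Definition hull_on (S : {set idx}) : set 'rV[R]_d :=
  [set x | exists l : idx -> R,
     [/\ forall i, 0 <= l i, \sum_i l i = 1, x = \sum_i l i *: V`_i
       & forall i, i \notin S -> l i = 0]]%classic.

Lemma point_in (i : idx) : (P : set _) V`_i.
Proof.
rewrite PV; exists (fun j => (j == i)%:R); split.
- by move=> j; rewrite ler0n.
- by rewrite (bigD1 i) //= eqxx big1 ?addr0 // => j /negPf ->.
- rewrite (bigD1 i) //= eqxx scale1r big1 ?addr0 // => j /negPf ->.
  by rewrite scale0r.
Qed.

Lemma face_functional F : exists c, [/\ forall i, 0 <= value c i,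
  generators F = [set i | value c i == 0]%SET & val F = hull_on (generators F)].
Proof.
have [a [b [Pb FE]]] := face_latticeP F.
exists (col_mx (- a) b%:M).
have vE i : value (col_mx (- a) b%:M) i = b - (V`_i *m a) 0 0.
  by rewrite value_col mulmxN !mxE eqxx mulr1n addrC.
have gE : generators F = [set i : idx | (V`_i *m a) 0 0 == b]%SET.
  apply/setP => i; rewrite !inE FE; apply/asboolP/eqP => [[]//|e].
  by split=> //; exact: point_in.
split.
- by move=> i; rewrite vE subr_ge0; apply: Pb; exact: point_in.
- by rewrite gE; apply/setP => i; rewrite !inE vE subr_eq0 eq_sym.
- rewrite gE FE PV face_hull -?PV // /hull_on; apply/seteqP.
  by split=> x [l [l0 l1 xl lb]]; exists l; split=> // i;
    [rewrite inE => h; exact: lb | move=> h; apply: lb; rewrite inE].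
Qed.

Lemma functional_face c : (forall i, 0 <= value c i) ->
  exists F, generators F = [set i | value c i == 0]%SET.
Proof.
move=> c0; pose a := - usubmx c; pose b := (dsubmx c) 0 0.
have vE i : value c i = b - (V`_i *m a) 0 0.
  by rewrite -[c in LHS]vsubmxK value_col mulmxN [in RHS]mxE opprK addrC.
have Pb x : (P : set _) x -> (x *m a) 0 0 <= b.
  rewrite PV => -[l [l0 l1 ->]]; rewrite mulmx_suml summxE -[b]mul1r -l1 mulr_suml.
  apply: ler_sum => i _; rewrite -scalemxAl mxE ler_wpM2l //.
  by rewrite -subr_ge0 -vE.
have fF : faces P [set x | (P : set _) x /\ (x *m a) 0 0 = b]%classic by exists a, b.
exists [` face_latticeI fF]%fset; apply/setP => i; rewrite !inE vE subr_eq0 eq_sym.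
apply/asboolP/eqP => [[]//|e]; split=> //; exact: point_in.
Qed.

Lemma mem_generators F (i : idx) : reflect (val F V`_i) (i \in generators F).
Proof. by rewrite inE; exact: asboolP. Qed.

Lemma face_leE F G : (F <= G)%O = (generators F \subset generators G).
Proof.
apply/idP/idP => [/face_lattice_leP FG|sub].
  by apply/subsetP => i /mem_generators h; apply/mem_generators/FG.
apply/face_lattice_leP.
have [_ [_ _ ->]] := face_functional F; have [_ [_ _ ->]] := face_functional G.
move=> x [l [l0 l1 xl lb]]; exists l; split=> // i iG; apply: lb.
by apply: contra iG; apply: (subsetP sub).
Qed.

Lemma face_ltE F G : (F < G)%O = (generators F \proper generators G).
Proof. by rewrite lt_leAnge !face_leE. Qed.

Definition lifted_span F : {vspace 'rV[R]_(d + 1)} :=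
  <<[seq lifted i | i <- enum (generators F)]>>%VS.
Definition face_rank F : nat := \dim (lifted_span F).

Lemma lifted_span_subv F (U : {vspace 'rV[R]_(d + 1)}) :
  reflect (forall i, i \in generators F -> lifted i \in U) (lifted_span F <= U)%VS.
Proof.
apply: (iffP span_subvP) => h.
  by move=> i iF; apply: h; rewrite map_f // mem_enum.
by move=> u /mapP[i]; rewrite mem_enum => iF ->; apply: h.
Qed.

Lemma mem_lifted_span F i : i \in generators F -> lifted i \in lifted_span F.
Proof. by apply/lifted_span_subv/subvv. Qed.

Lemma functional_span c F : (forall i, i \in generators F -> value c i = 0) ->
  forall v, v \in lifted_span F -> (v *m c) 0 0 = 0.
Proof.
move=> h v; have /subvP sub : (lifted_span F <= lker (linfun (mulmxr c)))%VS.
  apply/lifted_span_subv => i /h iF; rewrite memv_ker lfunE /=.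
  by apply/eqP/matrixP => a b; rewrite !ord1 [RHS]mxE.
by move/sub; rewrite memv_ker lfunE /= => /eqP ->; rewrite mxE.
Qed.

Lemma face_rank_lt F G : (F < G)%O -> (face_rank F < face_rank G)%N.
Proof.
rewrite face_ltE => /properP[/subsetP sub [i iG iF]].
have le : (lifted_span F <= lifted_span G)%VS.
  by apply/lifted_span_subv => k /sub; exact: mem_lifted_span.
rewrite ltn_neqAle (dimv_leqif_sup le) dimvS // andbT; apply/negP => /subvP le'.
have [c [_ cF _]] := face_functional F.
have := functional_span (c := c) (F := F) _ (le' _ (mem_lifted_span iG)).
move: iF; rewrite cF inE => /eqP ne h.
by apply: ne; apply: h => k; rewrite inE => /eqP.
Qed.

Lemma generators_bot : generators \bot%O = set0.
Proof.
by apply/setP => i; rewrite [RHS]inE; apply/negbTE/negP => /mem_generators.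
Qed.

Lemma face_rank_bot : face_rank \bot%O = 0%N.
Proof.
apply/eqP; rewrite /face_rank dimv_eq0 -subv0; apply/lifted_span_subv => i.
by rewrite generators_bot inE.
Qed.

(** A functional that is nonnegative on [G] only becomes nonnegative everywhere,
with the same zeros on [G], after adding a large multiple [K] of a functional
that vanishes exactly on [G]. *)
Lemma face_of_face G c : (forall i, i \in generators G -> 0 <= value c i) ->
  exists F, generators F = [set i in generators G | value c i == 0]%SET.
Proof.
move=> cG; have [g [g0 gG _]] := face_functional G.
pose K := 1 + \sum_(i | i \notin generators G) `|value c i| / value g i.
have pos i : i \notin generators G -> 0 < value g i.
  by rewrite gG inE lt_neqAle g0 andbT eq_sym.
have big i : i \notin generators G -> 0 < value (c + K *: g) i.
  move=> iG; have gi := pos i iG; rewrite valueD valueZ.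
  have : `|value c i| + value g i <= K * value g i.
    rewrite -ler_pdivrMr // mulrDl divff ?gt_eqF // addrC lerD2l.
    rewrite (bigD1 i) //= lerDl sumr_ge0 // => k /andP[kG _].
    by apply: divr_ge0 => //; apply/ltW/pos.
  have := ler_norm (- value c i); rewrite normrN; lra.
have small i : i \in generators G -> value (c + K *: g) i = value c i.
  by rewrite gG inE => /eqP e; rewrite valueD valueZ e mulr0 addr0.
have [|F FE] := @functional_face (c + K *: g).
  move=> i; have [iG|/big/ltW//] := boolP (i \in generators G).
  by rewrite small // cG.
exists F; rewrite FE; apply/setP => i; rewrite [LHS]in_set [RHS]in_set.
have [iG|iG] := boolP (i \in generators G); first by rewrite small.
by rewrite gt_eqF // big.
Qed.

(** The hyperplanes [c = t f] all contain [F].  Taking for [t] the largest slope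
[c / f] over the generators of [G] outside [F] makes [t f - c] nonnegative on [G]
and zero at a further generator.  The generators [i0] and [i1] have slopes zero
and nonzero, so [t f - c] is not identically zero on [G]. *)
Lemma rotate_hyperplane F G c i0 i1 : (F <= G)%O ->
  (forall i, i \in generators F -> value c i = 0) ->
  i0 \in generators G -> i0 \notin generators F -> value c i0 = 0 ->
  i1 \in generators G -> value c i1 != 0 ->
  forall f, (forall i, 0 <= value f i) -> generators F = [set i | value f i == 0]%SET ->
  exists (Z : face_lattice P) (t : R), [/\ (F < Z < G)%O,
    forall i, i \in generators G -> value c i <= t * value f i &
    forall i, i \in generators Z -> value c i = t * value f i].
Proof.
rewrite face_leE => /subsetP FG cF i0G i0F ci0 i1G ci1 f f0 fF.
have fpos i : i \notin generators F -> 0 < value f i.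
  by rewrite fF inE lt_neqAle f0 andbT eq_sym.
pose A := generators G :\: generators F.
pose k := [arg max_(i > i0 in A) (value c i / value f i)]%O.
have [kA kmax] : k \in A /\ forall i, i \in A -> value c i / value f i <= value c k / value f k.
  rewrite /k; case: arg_maxP => [|i iA imax]; last by split.
  by rewrite inE i0F.
pose t := value c k / value f k.
have vE i : value (t *: f - c) i = t * value f i - value c i by rewrite valueD valueN valueZ.
have le i : i \in generators G -> value c i <= t * value f i.
  move=> iG; have [iF|iF] := boolP (i \in generators F).
    by rewrite cF //; move: iF; rewrite fF inE => /eqP ->; rewrite mulr0.
  by rewrite -ler_pdivrMr ?fpos // kmax // inE iF.
have [|Z ZE] := @face_of_face G (t *: f - c).
  by move=> i /le; rewrite vE subr_ge0.
exists Z, t; split=> // [|i]; last first.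
  by rewrite ZE inE vE subr_eq0 => /andP[_ /eqP].
move: kA; rewrite inE => /andP[kF kG].
rewrite !face_ltE; apply/andP; split; apply/properP; split.
- apply/subsetP => i iF; rewrite ZE inE FG // vE cF //.
  by move: iF; rewrite fF inE => /eqP ->; rewrite mulr0 subr0 eqxx.
- exists k => //; rewrite ZE inE kG vE /t divfK ?subrr ?eqxx //.
  by rewrite gt_eqF // fpos.
- by apply/subsetP => i; rewrite ZE inE => /andP[].
- have [t0|t0] := eqVneq t 0.
    by exists i1; rewrite // ZE inE i1G vE t0 mul0r sub0r oppr_eq0.
  exists i0; rewrite // ZE inE i0G vE ci0 subr0 mulf_eq0 negb_or t0 /=.
  by rewrite gt_eqF // fpos.
Qed.

(** Rotating with [c] and with [- c] produces the faces of largest and of smallest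
slope; where both meet, [f] vanishes because the two slopes differ. *)
Lemma face_rank_gap F G : (F <= G)%O -> ((face_rank F).+2 <= face_rank G)%N ->
  exists Z1 Z2 : face_lattice P, [/\ (F < Z1 < G)%O, (F < Z2 < G)%O &
    forall W : face_lattice P, (W <= Z1)%O -> (W <= Z2)%O -> (W <= F)%O].
Proof.
move=> FG gap; have [f [f0 fF _]] := face_functional F.
have [i0 i0G i0F] : exists2 i, i \in generators G & i \notin generators F.
  apply/subsetPn; rewrite -face_leE; apply/negP => GF.
  by move: gap; rewrite (le_anti (_ : F <= G <= F)%O) ?FG // => /ltnW; rewrite ltnn.
(* Codimension two leaves room for a functional that vanishes on [F] and at
   [i0] but not on [G], that is, for two different slopes. *)
pose U := (lifted_span F + <[lifted i0]>)%VS.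
have [i1 i1G i1U] : exists2 i, i \in generators G & lifted i \notin U.
  apply: contrapT => no; suff : (lifted_span G <= U)%VS.
    move/dimvS; rewrite leqNgt => /negP; apply.
    apply: leq_ltn_trans (dimv_add_leqif _ _) _.
    rewrite dim_vline; apply: leq_ltn_trans gap.
    by rewrite -[in X in (_ <= X)%N]addn1 leq_add2l leq_b1.
  apply/lifted_span_subv => i iG; apply/negPn/negP => iU; apply: no.
  by exists i.
have [c [cU ci1]] := separating_functional i1U.
have cF i : i \in generators F -> value c i = 0.
  by move=> iF; apply: cU; apply: (subvP (addvSl _ _)); exact: mem_lifted_span.
have ci0 : value c i0 = 0.
  by apply: cU; apply: (subvP (addvSr _ _)); exact: memv_line.
have [Z1 [t1 [FZ1 le1 e1]]] := rotate_hyperplane FG cF i0G i0F ci0 i1G ci1 f0 fF.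
have [|||Z2 [t2 [FZ2 le2 e2]]] :=
    @rotate_hyperplane F G (- c) i0 i1 FG _ i0G i0F _ i1G _ f f0 fF.
- by move=> i /cF; rewrite valueN => ->; rewrite oppr0.
- by rewrite valueN ci0 oppr0.
- by rewrite valueN oppr_eq0.
exists Z1, Z2; split=> // W; rewrite !face_leE => /subsetP WZ1 /subsetP WZ2.
have t12 : t1 + t2 != 0.
  apply/eqP => t0; have t2E : t2 = - t1 by lra.
  have eq i : i \in generators G -> value c i = t1 * value f i.
    move=> iG; have := le1 i iG; have := le2 i iG; rewrite valueN t2E mulNr; lra.
  have := eq _ i0G; rewrite ci0 => /esym/eqP; rewrite mulf_eq0 => /orP[/eqP t10|fi0].
    by move: ci1; rewrite -/(value c i1) eq // t10 mul0r eqxx.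
  by move: i0F; rewrite fF inE fi0.
apply/subsetP => i iW; rewrite fF inE.
have := e1 i (WZ1 i iW); have := e2 i (WZ2 i iW); rewrite valueN => h2 h1.
have : (t1 + t2) * value f i = 0 by rewrite mulrDl -h1 -h2 subrr.
by move/eqP; rewrite mulf_eq0 (negbTE t12).
Qed.

Lemma has_dim_unique (S : set 'rV[R]_d) k1 k2 : has_dim S k1 -> has_dim S k2 -> k1 = k2.
Proof.
have le k k' : has_dim S k -> has_dim S k' -> (k <= k')%N.
  move=> [x0 Sx0 [U [<- _ Umin]]] [y0 Sy0 [W [<- WS _]]].
  apply: dimvS; apply: Umin => x Sx.
  have -> : x - x0 = (x - y0) - (x0 - y0) by rewrite opprB addrA subrK.
  by rewrite rpredB ?WS.
by move=> h1 h2; apply/eqP; rewrite eqn_leq !le.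
Qed.

(** The linear map [(x, r) |-> x - r v], for the generator [v] of index [i0], sends
the lifted span onto the direction of the affine hull, and its kernel is the
line of the lifted [v]. *)
Lemma has_dim_face_rank F i0 : i0 \in generators F ->
  has_dim (val F) (face_rank F).-1 /\ (0 < face_rank F)%N.
Proof.
move=> i0F; pose M : 'M[R]_(d + 1, d) := col_mx 1%:M (- V`_i0).
pose f := linfun (mulmxr M) : 'Hom('rV[R]_(d + 1), 'rV[R]_d).
have fE i : f (lifted i) = V`_i - V`_i0.
  by rewrite lfunE /= /lifted mul_row_col mulmx1 mul1mx.
have kerE : (lifted_span F :&: lker f)%VS = <[lifted i0]>%VS.
  apply/eqP; rewrite eqEsubv; apply/andP; split; last first.
    rewrite -memvE memv_cap mem_lifted_span //= memv_ker fE subrr eqxx //.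
  apply/subvP => v; rewrite memv_cap memv_ker lfunE /= => /andP[_].
  rewrite -[v]hsubmxK mul_row_col mulmx1 mulmxN subr_eq0 => /eqP e.
  apply/vlineP; exists ((rsubmx v) 0 0).
  rewrite e [X in row_mx _ X]mx11_scalar [X in row_mx (X *m _) _]mx11_scalar.
  by rewrite /lifted scale_row_mx mul_scalar_mx scale_scalar_mx mulr1.
have := limg_ker_dim f (lifted_span F); rewrite kerE dim_vline.
have -> : lifted i0 != 0.
  apply/eqP => /matrixP/(_ 0 (rshift d 0)); rewrite row_mxEr !mxE eqxx => /eqP.
  by rewrite mulr1n oner_eq0.
rewrite add1n => dimE; rewrite /face_rank -dimE; split=> //=.
exists V`_i0; first exact/mem_generators.
exists (f @: lifted_span F)%VS; split=> //.
  have [_ [_ _ ->]] := face_functional F => x [l [_ l1 -> lF]].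
  have -> : \sum_i l i *: V`_i - V`_i0 = \sum_i l i *: (f (lifted i)).
    rewrite -[V`_i0 in LHS]scale1r -l1 scaler_suml -sumrB.
    by apply: eq_bigr => i _; rewrite fE scalerBr.
  apply: rpred_sum => i _; have [iF|/lF ->] := boolP (i \in generators F).
    by apply: rpredZ; apply: memv_img; exact: mem_lifted_span.
  by rewrite scale0r mem0v.
move=> W WF; rewrite limg_span; apply/span_subvP => u.
case/mapP => _ /mapP[i iF ->] ->; rewrite fE; apply: WF.
by apply/mem_generators; rewrite -mem_enum.
Qed.

Lemma has_dimP F k : has_dim (val F) k <-> face_rank F = k.+1.
Proof.
split=> h.
  have [i iF] : exists i, i \in generators F.
    apply: contrapT => no; case: h => x Fx _; move: Fx.
    have [_ [_ _ ->]] := face_functional F => -[l [_ l1 _ lF]].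
    have : \sum_i l i = 0 by apply: big1 => i _; apply: lF; apply/negP => iF; apply: no; exists i.
    by rewrite l1 => /eqP; rewrite oner_eq0.
  have [h' rk_gt0] := has_dim_face_rank iF.
  by rewrite -(has_dim_unique h' h) prednK.
have [e|[i iF]] := set_0Vmem (generators F); last first.
  by have [h' _] := has_dim_face_rank iF; rewrite h in h'.
suff e' : face_rank F = 0%N by rewrite e' in h.
apply/eqP; rewrite /face_rank dimv_eq0 -subv0; apply/lifted_span_subv => i.
by rewrite e inE.
Qed.
End Geometry.

Theorem theorem3p4 (R : realType) (d n : nat) (P : polytope R d)
    (gamma : 'I_(n./2).+1 -> int) :
  has_dim P n -> is_simple P n -> is_gamma_vector P n gamma ->
  toric_g (face_lattice P) = \sum_(j < (n./2).+1) gamma j *: g_nj n j.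
Proof.
move=> dimP simpleP gammaP; have [V PV] := polytopeP P.
pose rk : face_lattice P -> nat := face_rank V.
have rk_lt (F G : face_lattice P) : (F < G)%O -> (rk F < rk G)%N by exact: face_rank_lt.
have rk0 : rk \bot%O = 0%N by exact: face_rank_bot.
have rk_gap (F G : face_lattice P) := face_rank_gap PV (F := F) (G := G).
have rkP (F : face_lattice P) k : has_dim (val F) k <-> rk F = k.+1 by exact: has_dimP.
have rk1 : rk \top%O = n.+1 by apply/rkP.
have rkE := poset_rankE rk_lt rk0 rk_gap.
have simple v : rk v = 1%N -> #|coatoms_above rk n v| = n.
  move=> v1; rewrite -[RHS](simpleP v); last by apply/rkP.
  apply: eq_card => F; rewrite !inE; have [vF|] := boolP (v <= F)%O; last by rewrite !andbF.
  rewrite !andbT; apply/eqP/asboolP => [FE|[k /rkP -> //]].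
  have Fpos : (0 < rk F)%N.
    by rewrite (leq_trans _ (rk_le rk_lt vF)) // v1.
  by exists n.-1; [apply/rkP; rewrite prednK -?FE | rewrite prednK -?FE].
have cards := card_between rk_lt rk0 rk_gap rk1 simple.
have fE i : f_number P i = #|[set F : face_lattice P | rk F == i.+1]%SET|.
  by apply: eq_card => F; rewrite !inE; apply/asboolP/eqP => /rkP.
pose s := [seq (gamma j, j : nat) | j <- enum 'I_(n./2).+1].
have sumE (W : lmodType int) (f : nat -> W) :
    \sum_(e <- s) e.1 *: f e.2 = \sum_(j < (n./2).+1) gamma j *: f j.
  by rewrite big_map big_enum.
have pick (W : lmodType int) (f : face_lattice P -> W) :
    \sum_(y | rk y == n.+1) (y == \top%O)%:R *: f y = f \top%O.
  rewrite (bigD1 \top%O) ?rk1 //= eqxx scale1r big1 ?addr0 // => y /andP[_ /negbTE ->].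
  by rewrite scale0r.
rewrite /toric_g -(pick _ (@toric_g_interval _ _)) -(sumE _ (g_nj n)).
apply: (gamma_expansion rk_lt rk0 rkE cards).
  by apply/allP => _ /mapP[j _ ->] /=; have := ltn_ord j; lia.
rewrite pick sumE (face_poly_top rk_lt rk0 rk1).
have := congr1 (fun p : {poly int} => p \Po ('X + 1)) gammaP.
rewrite !raddf_sum /= => h.
under eq_bigr do rewrite -fE.
(* Substituting ['X + 1] passes from [x] to the shifted variable. *)
transitivity (\sum_(i < n.+1) (((f_number P i)%:R * ('X - 1) ^+ i) \Po ('X + 1)) : {poly int}).
  apply: eq_bigr => i _; rewrite !mulr_natl raddfMn /= rmorphXn /=.
  by rewrite comp_polyB comp_polyX -polyC1 comp_polyC addrK.
rewrite h; apply: eq_bigr => j _; rewrite comp_polyZ; congr (_ *: _).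
rewrite /gamma_basis comp_polyM !rmorphXn /= comp_polyD comp_polyX -polyC1 comp_polyC polyC1.
by congr (_ * _ ^+ _); ring.
Qed.
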